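(* For every $\varepsilon>0$ and every sequence $\ell=\ell(n)$ of positive integers with $\ell\ge (1+\varepsilon)n$ for all $n$, almost all $\ell$-lifts of $K_n$ have Hajós number equal to $n$; that is, if $G$ is a uniformly random $\ell$-lift of $K_n$, then the probability that the Hajós number of $G$ equals $n$ tends to $1$ as $n\to\infty$.
   Context: An $\ell$-lift of a graph $H$ is a graph obtained by replacing every vertex $v$ of $H$ by an independent set (the fiber of $v$) of $\ell$ vertices, say $\{v\}\times\{1,\dots,\ell\}$, and placing, for each edge $uv$ of $H$, a perfect matching (of size $\ell$) between the fibers of $u$ and $v$; there are no other edges. A uniformly random $\ell$-lift of $H$ is obtained by choosing, independently for each edge $uv$ of $H$, a uniformly random perfect matching between the fibers of $u$ and $v$. Almost all $\ell$-lifts of $K_n$ satisfy a property if the proportion of $\ell$-lifts of $K_n$ failing it tends to $0$ as $n\to\infty$. A topological clique of order $m$ (equivalently, a subdivision of $K_m$) is a graph consisting of $m$ branch vertices, all pairs of which are joined by pairwise internally vertex-disjoint paths (one path for each pair, whose internal vertices are not branch vertices). The Hajós number of a graph is the largest $m$ such that it contains a topological clique of order $m$ as a subgraph. The condition ''$\ell\ge(1+o(1))n$'' is expressed as: for every fixed $\varepsilon>0$, the conclusion holds whenever $\ell\ge(1+\varepsilon)n$. *)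

(* Defs.v *)
From mathcomp Require Import all_boot all_order all_algebra all_fingroup.
From mathcomp Require Import all_classical all_reals all_analysis.
Set Implicit Arguments.
Unset Strict Implicit.
Unset Printing Implicit Defensive.

(* Graphs are adjacency relations on finite types. *)

(* A topological clique of order m in e as a subgraph: b gives the branch
   vertices and, for i < j, P i j lists the internal vertices of the path
   from b i to b j in order; P i j is irrelevant when j <= i. *)
Definition topological_clique (T : finType) (e : rel T) (m : nat)
    (b : 'I_m -> T) (P : 'I_m -> 'I_m -> seq T) : Prop :=
  [/\ injective b,
      forall i j : 'I_m, i < j ->
        path e (b i) (rcons (P i j) (b j)) /\ uniq (P i j),
      forall i j k : 'I_m, i < j -> b k \notin P i j
    & forall i j i' j' : 'I_m, i < j -> i' < j' -> (i, j) <> (i', j') ->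
        forall x, x \in P i j -> x \notin P i' j'].

Definition has_topological_clique (T : finType) (e : rel T) (m : nat) : Prop :=
  exists (b : 'I_m -> T) (P : 'I_m -> 'I_m -> seq T),
    topological_clique e b P.

Lemma has_topological_clique0 (T : finType) (e : rel T) :
  exists m, `[< has_topological_clique e m >].
Proof.
have b : 'I_0 -> T by case.
by exists 0; apply/asboolP; exists b, (fun _ _ => [::]); split=> -[].
Qed.

Lemma has_topological_clique_bound (T : finType) (e : rel T) (m : nat) :
  `[< has_topological_clique e m >] -> m <= #|T|.
Proof.
move=> /asboolP[b [P [b_inj _ _ _]]].
by rewrite -[m]card_ord; apply: leq_card b_inj.
Qed.

Definition hajos_number (T : finType) (e : rel T) : nat :=
  ex_maxn (has_topological_clique0 e) (@has_topological_clique_bound T e).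

Definition complete_graph (n : nat) : rel 'I_n := fun u v => u != v.

(* Each edge of the simple graph H is represented once, by its endpoints in
   increasing order. *)
Definition edge (n : nat) (H : rel 'I_n) : finType :=
  {uv : 'I_n * 'I_n | (uv.1 < uv.2) && H uv.1 uv.2}.

(* A perfect matching between the fibers of u < v is the graph of a permutation
   s, matching (u, i) with (v, s i). Distinct families of permutations give
   distinct lifts, so that the uniform distribution on this finite product is
   that of independent uniform perfect matchings. *)
Definition lift_of (n : nat) (H : rel 'I_n) (l : nat) : finType :=
  {ffun edge H -> {perm 'I_l}}.

Definition lift_adj (n : nat) (H : rel 'I_n) (l : nat) (s : lift_of H l) :
    rel ('I_n * 'I_l) := fun x y =>
  [exists a : edge H,
     let: (u, v) := \val a in
     [&& x.1 == u, y.1 == v & y.2 == s a x.2]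
     || [&& y.1 == u, x.1 == v & x.2 == s a y.2]].

Definition lift_probability (R : realType) (n : nat) (H : rel 'I_n) (l : nat)
    (Q : rel ('I_n * 'I_l) -> bool) : R :=
  (#|[set s : lift_of H l | Q (lift_adj s)]|%:R / #|lift_of H l|%:R)%R.

(* Main.v *)
Require Import Defs.
From mathcomp Require Import all_boot all_order all_algebra all_fingroup.
From mathcomp Require Import all_classical all_reals all_analysis.
From mathcomp Require Import zify ring lra.
Set Implicit Arguments.
Unset Strict Implicit.
Unset Printing Implicit Defensive.
Import Order.TTheory GRing.Theory Num.Theory numFieldNormedType.Exports.

(** A vertex of a lift of [K_n] has at most one neighbour in each other fiber,
    so its degree is at most [n - 1] and no topological clique has more than [n]
    branch vertices ([topological_clique_lift]). The work lies in finding one of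
    order [n] in almost every lift.

    All branch vertices are taken in the fiber over 0: they are [(0, i)] for
    [i < n]. Each of them must then use all its [n - 1] neighbours, and the
    neighbour of [(0, i)] in the fiber over [v] can be renamed [(v, i)] without
    changing the distribution of the matchings between the other fibers
    ([normalise]). So a random lift carries [n (n - 1)] terminals [(v, i)],
    arranged in rows [i], and every pair of rows must receive one path, each
    terminal being the end of exactly one path. Since [l >= (1 + eps) n], a
    constant proportion of the vertices are spare, that is, neither in the fiber
    over 0 nor terminals; but there are about [n ^ 2 / 2] paths to draw, so most
    of them cannot afford inner spare vertices when [l] is close to [n].

    Most pairs of rows are therefore joined by a single edge between two
    terminals. Choose, for every row, a bijection from the other rows to its
    terminals so that as many pairs as possible are joined by an edge, and let [M]
    be the set of the other pairs. As swapping two values of a bijection does not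
    help, there is no edge at all between the terminals of row [i] assigned to [M]
    and those of row [j], for any [(i, j)] in [M] ([exists_pairing]). If [M] is
    large, then for fixed [M] and fixed terminals this has probability at most
    [16 ^ (- n ^ 2)] ([pr_no_hits]), and there are at most [4 ^ (n ^ 2)] choices.
    When [l] exceeds [n] by a large logarithmic factor, there is enough room to
    skip this step.

    The remaining pairs are joined through spare vertices by paths of length
    [O(log (n l))], found one after another by the method of Friedman and
    Pippenger. The used vertices are kept extendable: every set of at most [2 m]
    vertices has many unused neighbours. An extendable set can grow by a
    neighbour of any prescribed vertex ([sprout]), and added vertices can be
    removed again ([rollback]). Growing binary trees from two terminals until
    they have [m] leaves each, joining two leaves by an edge, and removing all
    vertices outside the resulting path yields [connect]. This needs two
    properties of a random lift, both proved by a union bound from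
    [no_edge_bound]: any two sets of [m] vertices are joined by an edge
    ([pr_not_joined]), and sets of at most [2 m] vertices have twice as many
    spare neighbours ([pr_not_expanding]). *)

(** * Extendable vertex sets *)

Section Extendability.
Import mathcomp.boot.fintype mathcomp.boot.finset.
Variables (V : finType) (e : rel V) (m : nat).
Implicit Types (U W A B K X Y : {set V}) (c : V -> nat).

Definition nbhd U : {set V} := [set y | [exists x in U, e x y]].

Definition joined : Prop := forall X Y, m <= #|X| -> m <= #|Y| ->
  exists x y, [/\ x \in X, y \in Y & e x y].

(** [W] is the set of used vertices, and [c v] the number of unused neighbours
    that [v] may still claim. This is the extendability of Friedman and
    Pippenger, stated as a Hall condition on sets of bounded size in terms of
    demands instead of degrees in a partial embedding. *)
Definition extendable W c : Prop := forall U, #|U| <= m.*2 ->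
  \sum_(u in U) c u <= #|nbhd U :\: W|.

Lemma nbhdP U y : reflect (exists2 x, x \in U & e x y) (y \in nbhd U).
Proof. by rewrite inE; apply: exists_inP. Qed.

Lemma nbhdS U1 U2 : U1 \subset U2 -> nbhd U1 \subset nbhd U2.
Proof.
move=> /subsetP s12; apply/subsetP => y /nbhdP[x xU xy].
by apply/nbhdP; exists x; first exact: s12.
Qed.

Lemma nbhdU U1 U2 : nbhd (U1 :|: U2) = nbhd U1 :|: nbhd U2.
Proof.
apply/setP => y; rewrite in_setU; apply/nbhdP/orP.
- by move=> [x /setUP[xU|xU] xy]; [left|right]; apply/nbhdP; exists x.
- by case=> /nbhdP[x xU xy]; exists x; rewrite // inE xU ?orbT.
Qed.

Lemma nbhd_joined U : joined -> m <= #|U| -> #|V| < #|nbhd U| + m.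
Proof.
move=> Jm mU; rewrite ltnNge; apply/negP => le.
have [|x [y [xU]]] := Jm U (~: nbhd U) mU.
  by rewrite cardsCs setCK; lia.
by rewrite in_setC => /nbhdP ny xy; apply: ny; exists x.
Qed.

Lemma extendable_le W c c' :
  (forall v, c' v <= c v) -> extendable W c -> extendable W c'.
Proof. by move=> le_c ext U /ext; apply: leq_trans; apply: leq_sum. Qed.

Lemma card_nbhdD_submod W A B :
  #|nbhd (A :|: B) :\: W| + #|nbhd (A :&: B) :\: W| <=
  #|nbhd A :\: W| + #|nbhd B :\: W|.
Proof.
rewrite nbhdU setDUl -[leqRHS]cardsUI leq_add2l subset_leq_card //.
by rewrite subsetI !setSD ?nbhdS ?subsetIl ?subsetIr.
Qed.

(** If adding [y] breaks extendability, then some set [U] is tight, avoids [s]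
    and has [y] among its neighbours. Tight sets are closed under union by
    submodularity, joinedness keeping them smaller than [m]. If every unused
    neighbour of [s] were bad, then the union of all these tight sets would
    contain all unused neighbours of [s] in its neighbourhood, and adding [s] to
    it would violate extendability. *)
Lemma sprout W c s :
  joined -> extendable W c -> (forall v, c v <= 2) ->
  #|W| + 5 * m <= #|V| -> 0 < m -> 0 < c s ->
  exists y, [/\ e s y, y \notin W &
    extendable (y |: W) (fun v => c v - (v == s))].
Proof.
move=> Jm ext c2 space m0 cs.
pose crit U := (#|U| <= m.*2) && (#|nbhd U :\: W| <= \sum_(u in U) c u).
have crit_lt U : crit U -> #|U| < m.
  move=> /andP[U2 Ule]; rewrite ltnNge; apply/negP => mU.
  have := nbhd_joined Jm mU.
  have sc : \sum_(u in U) c u <= #|U| * 2 by rewrite -sum_nat_const leq_sum.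
  have := cardsID W (nbhd U).
  have : #|nbhd U :&: W| <= #|W| by rewrite subset_leq_card ?subsetIr.
  by rewrite -mul2n in U2; lia.
have critU A B : crit A -> crit B -> crit (A :|: B).
  move=> cA cB; have lA := crit_lt _ cA; have lB := crit_lt _ cB.
  case/andP: cA => A2 Ale; case/andP: cB => B2 Ble.
  have AB2 : #|A :|: B| <= m.*2.
    by rewrite -addnn; apply: leq_trans (leq_card_setU _ _) _; lia.
  rewrite /crit AB2 /=.
  have /ext I : #|A :&: B| <= m.*2.
    by apply: leq_trans A2; rewrite subset_leq_card ?subsetIl.
  have := card_nbhdD_submod W A B.
  have : \sum_(u in A :|: B) c u + \sum_(u in A :&: B) c u =
         \sum_(u in A) c u + \sum_(u in B) c u.
    have sumE (D : {set V}) : \sum_(u in D) c u = \sum_u (u \in D) * c u.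
      by rewrite big_mkcond; apply: eq_bigr => u _; case: (u \in D); rewrite ?mul1n.
    rewrite !sumE -!big_split; apply: eq_bigr => u _ /=.
    by rewrite in_setU in_setI; case: (u \in A); case: (u \in B); lia.
  by lia.
pose good y := `[< extendable (y |: W) (fun v => c v - (v == s)) >].
pose N := [set y | e s y] :\: W.
case: (pickP (fun y => (y \in N) && good y)) => [y /andP[]|none].
  by rewrite !inE => /andP[yW sy] /asboolP ext'; exists y.
(* A single tight set seeing all unused neighbours of s suffices. *)
suff [U [critU' sU NU]] : exists U, [/\ crit U, s \notin U & N \subset nbhd U].
  have Ulm := crit_lt _ critU'; case/andP: critU' => _ Ule.
  have := ext (s |: U) _; rewrite cardsU1 sU -addnn big_setU1 //=.
  have -> : nbhd (s |: U) :\: W = nbhd U :\: W.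
    rewrite nbhdU setDUl; apply/setUidPr; apply/subsetP => y /setDP[/nbhdP[x]].
    rewrite inE => /eqP -> sy yW; rewrite in_setD yW (subsetP NU) //.
    by rewrite !inE yW.
  by move=> /(_ ltac:(lia)); lia.
have key y : y \in N -> exists U, [/\ crit U, s \notin U & y \in nbhd U].
  move=> yN; have /negbT := none y; rewrite yN /= => /asboolPn.
  move/existsNP => [U /not_implyP[U2 /negP]]; rewrite -ltnNge => lt.
  have extU := ext U U2.
  move: yN; rewrite !inE => /andP[yW sy].
  have D1 : nbhd U :\: (y |: W) = (nbhd U :\: W) :\ y.
    by rewrite setUC setDDl.
  have D2 := cardsD1 y (nbhd U :\: W); rewrite -D1 in_setD yW /= in D2.
  have le1 : \sum_(u in U) c u = \sum_(u in U) (c u - (u == s)) + (s \in U).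
    have -> : nat_of_bool (s \in U) = \sum_(u in U) (u == s).
      rewrite (bigID (pred1 s)) /= [X in _ + X]big1 ?addn0; last first.
        by move=> u /andP[_ /negPf ->].
      by rewrite (eq_bigr (fun=> 1)) ?big_mkcondl ?big_pred1_eq => [|u /andP[_ ->]//]; case: ifP.
    by rewrite -big_split; apply: eq_bigr => u _ /=; case: eqP => [->|_]; lia.
  have [sU|sU] := boolP (s \in U).
    have : y \in nbhd U by apply/nbhdP; exists s.
    by move=> yU; rewrite yU in D2; rewrite sU in le1; lia.
  rewrite (negPf sU) in le1.
  exists U; split=> //; first by rewrite /crit U2 /=; lia.
  by case: (boolP (y \in nbhd U)) D2 => // yU /=; lia.
have : forall r : seq V, {subset r <= N} ->
    exists U, [/\ crit U, s \notin U & {subset r <= nbhd U}].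
  elim=> [_|y r IH sub].
    exists set0; split=> //; last by rewrite inE.
    rewrite /crit cards0 big_set0 /= leqn0 cards_eq0 -subset0.
    by apply/subsetP => z /setDP[/nbhdP[x]]; rewrite inE.
  have [|U1 [c1 s1 r1]] := IH; first by move=> z zr; apply: sub; rewrite inE zr orbT.
  have [|U2 [c2' s2 y2]] := key y; first by apply: sub; rewrite mem_head.
  exists (U1 :|: U2); split; first exact: critU.
    by rewrite inE negb_or s1.
  move=> z; rewrite inE nbhdU in_setU => /orP[/eqP->|/r1->//].
  by rewrite y2 orbT.
move=> /(_ (enum N)) [|U [cU sU NU]]; first by move=> y; rewrite mem_enum.
by exists U; split=> //; apply/subsetP => y yN; apply: NU; rewrite mem_enum.
Qed.

End Extendability.

(** * Disjoint paths between prescribed pairs *)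

Section Linking.
Import mathcomp.boot.fintype mathcomp.boot.finset.
Variables (V : finType) (e : rel V) (m : nat).
Hypotheses (e_sym : symmetric e) (e_joined : joined e m) (m_gt0 : 0 < m).
Implicit Types (U W A B K X Y Z : {set V}) (c : V -> nat).
Local Notation extendable := (extendable e m).

(** The two children of [x] are [f (x, true)] and [f (x, false)]. As every
    unused vertex may claim two neighbours, the children can be split in turn:
    this is one level in the growth of a binary forest. *)
Lemma sprout_twice W c K :
  extendable W c -> (forall v, c v <= 2) -> {in K, forall x, c x = 2} ->
  #|W| + 2 * #|K| + 5 * m <= #|V| ->
  exists f : V * bool -> V,
    [/\ {in setX K [set: bool], forall p, e p.1 (f p) /\ f p \notin W},
        {in setX K [set: bool] &, injective f} &
        extendable (W :|: f @: setX K [set: bool])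
          (fun v => if v \in K then 0 else c v)].
Proof.
move=> ext c2; move Dk: #|K| => k; elim: k K Dk => [|k IH] K Dk cK space.
  have {Dk cK}-> : K = set0 by apply/eqP; rewrite -cards_eq0 Dk.
  exists fst; split=> [p|p|]; rewrite ?inE //.
  move=> U U2; apply: leq_trans (leq_trans (ext U U2) _).
    by apply: leq_sum => v _; rewrite inE.
  rewrite subset_leq_card // setDS // subUset subxx /=.
  by apply/subsetP => v /imsetP[p]; rewrite !inE.
have [x xK] : exists x, x \in K by apply/set0Pn; rewrite -card_gt0 Dk.
set K' := K :\ x; have DK : #|K'| = k by move: Dk; rewrite (cardsD1 x) xK => -[].
have [||f [fe finj fext]] := IH K' DK.
- by move=> v /setD1P[_ /cK].
- lia.
set F := f @: setX K' [set: bool] in fext.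
have cardF : #|F| = 2 * k.
  by rewrite card_in_imset // cardsX cardsT card_bool DK mulnC.
have cardWF : #|W :|: F| <= #|W| + 2 * k.
  by rewrite -cardF; apply: leq_card_setU.
have xK' : x \notin K' by rewrite !inE eqxx.
have [| |||y1 [xy1 y1W ext1]] := sprout (s := x) e_joined fext.
- by move=> v; case: ifP.
- by lia.
- by [].
- by rewrite (negPf xK') cK.
have [| ||y2 [xy2 y2W ext2]] := sprout (s := x) e_joined ext1 _ _ m_gt0.
- by move=> v; case: ifP => // _; rewrite ?sub0n // (leq_trans (leq_subr _ _)).
- by rewrite cardsU1 y1W; lia.
- by rewrite (negPf xK') eqxx cK.
move: y2W; rewrite in_setU1 negb_or => /andP[y21 y2W].
pose g p := if p.1 == x then if p.2 then y1 else y2 else f p.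
have gE p : p.1 != x -> g p = f p by rewrite /g => /negPf->.
have inF p : p \in setX K [set: bool] -> p.1 != x -> f p \in F.
  by rewrite !inE andbT => pK px; apply: imset_f; rewrite !inE px pK.
move: y1W y2W; rewrite !in_setU !negb_or => /andP[y1W y1F] /andP[y2W y2F].
exists g; split.
- move=> p pK; rewrite /g; case: eqP => [->|/eqP px].
    by case: ifP.
  by apply: fe; move: pK; rewrite !inE px.
- move=> p q pK qK; rewrite /g; case: (eqVneq p.1 x) => [px|px];
    case: (eqVneq q.1 x) => [qx|qx].
  + have pq1 : p.1 = q.1 by rewrite px qx.
    case: p q pq1 {pK qK px qx} => [p1 p2] [q1 q2] /= ->.
    by case: p2; case: q2 => // y12; rewrite y12 eqxx in y21.
  + by case: ifP => _ yq; move: (inF q qK qx); rewrite -yq ?(negPf y1F) ?(negPf y2F).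
  + by case: ifP => _ yp; move: (inF p pK px); rewrite yp ?(negPf y1F) ?(negPf y2F).
  + by apply: finj; move: pK qK; rewrite !inE ?px ?qx.
have -> : W :|: g @: setX K [set: bool] = y2 |: (y1 |: (W :|: F)).
  apply/setP => v; rewrite !in_setU !in_set1; apply/idP/idP.
    case/orP => [->|/imsetP[p pK ->]]; first by rewrite !orbT.
    rewrite /g; case: (eqVneq p.1 x) => [_|px]; last by rewrite (inF p) // !orbT.
    by case: ifP; rewrite eqxx ?orbT.
  case/orP => [/eqP->|/orP[/eqP->|/orP[->//|/imsetP[p]]]].
  - by apply/orP; right; apply/imsetP; exists (x, false); rewrite ?inE ?xK /g /= ?eqxx.
  - by apply/orP; right; apply/imsetP; exists (x, true); rewrite ?inE ?xK /g /= ?eqxx.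
  rewrite !inE andbT => /andP[px pK] ->; apply/orP; right; apply/imsetP.
  by exists p; rewrite ?inE ?pK ?gE.
apply: extendable_le ext2 => v; rewrite [v \in K']in_setD1.
by case: (eqVneq v x) => [->|_] /=; rewrite ?xK ?subn0.
Qed.

(** A removed vertex becomes an unused neighbour of its parent, so the parent
    gets its demand back. *)
Lemma rollback W c Z K (f : V * bool -> V) :
  {in setX K [set: bool], forall p, e p.1 (f p) /\ f p \in Z} ->
  {in setX K [set: bool] &, injective f} -> Z \subset W ->
  extendable W c -> extendable (W :\: Z) (fun v => c v + 2 * (v \in K)).
Proof.
move=> fe finj ZW ext U /ext le.
rewrite big_split /= -big_distrr /=.
have -> : \sum_(u in U) (u \in K) = #|U :&: K|.
  rewrite -sum1_card (eq_bigr (fun u => if u \in K then 1 else 0)).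
    by rewrite -big_mkcondr; apply: eq_bigl => u; rewrite in_setI.
  by move=> u _; case: (u \in K).
set F := f @: setX (U :&: K) [set: bool].
have sub : setX (U :&: K) [set: bool] \subset setX K [set: bool].
  by apply/subsetP => p; rewrite !inE !andbT => /andP[].
have cF : #|F| = 2 * #|U :&: K|.
  rewrite card_in_imset; first by rewrite cardsX cardsT card_bool mulnC.
  by move=> p q /(subsetP sub) pK /(subsetP sub) qK; apply: finj.
have disj : (nbhd e U :\: W) :&: F = set0.
  apply/setP => v; rewrite !inE; apply/negP => /andP[/andP[vW _] /imsetP[p pK Dv]].
  have [_ ] := fe p (subsetP sub p pK).
  by rewrite -Dv => /(subsetP ZW); rewrite (negPf vW).
rewrite -cF; apply: leq_trans (leq_add le (leqnn _)) _.
rewrite -[leqLHS]subn0 -(cards0 V) -disj -cardsU subset_leq_card //.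
apply/subsetP => v /setUP[/setDP[vU vW]|/imsetP[p pK ->]].
  by rewrite !in_setD vU (negPf vW) andbF.
have [ep pZ] := fe p (subsetP sub p pK).
rewrite in_setD in_setD pZ /=; apply/nbhdP; exists p.1 => //.
by move: pK; rewrite !inE andbT => /andP[].
Qed.

(** One induction step grows a level: the children of [A] and [B] replace [A]
    and [B], and after [h] levels both sets have at least [m] elements, hence are
    joined by an edge. On the way back all children outside the path found are
    released, which restores the demand 2 of all vertices of [A] and [B] but the
    two ends of the path. *)
Lemma connect h W c A B :
  extendable W c -> (forall v, c v <= 2) ->
  {in A :|: B, forall v, c v = 2} -> (forall v, v \notin W -> c v = 2) ->
  A :|: B \subset W -> [disjoint A & B] -> #|A| = #|B| ->
  m <= #|A| * 2 ^ h -> #|W| + 4 * (#|A| * (2 ^ h - 1)) + 5 * m <= #|V| ->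
  exists a b P, [/\ [/\ a \in A, b \in B & path e a (rcons P b)], uniq P,
    {in P, forall v, v \notin W}, size P <= 2 * h &
    extendable (W :|: [set v in P])
      (fun v => if v \in [:: a, b & P] then 0 else c v)].
Proof.
elim: h W c A B => [|h IH] W c A B ext c2 cAB cW AB dAB cardAB mA space.
  have [||a [b [aA bB ab]]] := e_joined (X := A) (Y := B).
  - by lia.
  - by lia.
  exists a, b, [::]; split=> //=; first by rewrite ab.
  have -> : W :|: [set v in [::]] = W by apply/setP => v; rewrite !inE orbF.
  by apply: extendable_le ext => v; case: ifP.
have h2 : 0 < 2 ^ h by rewrite expn_gt0.
rewrite expnS in mA space.
have cardU : #|A :|: B| = 2 * #|A|.
  by rewrite cardsU disjoint_setI0 // cards0 -cardAB; lia.
have space' : 4 * #|A| + 4 * (2 * #|A| * (2 ^ h - 1)) = 4 * (#|A| * (2 * 2 ^ h - 1)).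
  have : 1 <= 2 ^ h by []. move: (2 ^ h) => x x1; nia.
have [|f [fe finj fext]] := sprout_twice ext c2 cAB.
  by rewrite cardU; nia.
set K := A :|: B in fe finj fext cardU *; set c1 := fun v => _ in fext.
pose G X := f @: setX X [set: bool].
have GU : G K = G A :|: G B.
  apply/setP => v; rewrite in_setU; apply/imsetP/orP.
    move=> [p]; rewrite !inE andbT => /orP[] pX ->; [left|right];
      by apply: imset_f; rewrite !inE pX.
  by case=> /imsetP[p pX ->]; exists p => //; move: pX; rewrite !inE !andbT => ->;
    rewrite ?orbT.
have AK : A \subset K by apply: subsetUl.
have BK : B \subset K by apply: subsetUr.
have injX X : X \subset K -> {in setX X [set: bool] &, injective f}.
  move=> XK p q; rewrite !inE !andbT => pX qX; apply: finj;
    by rewrite !inE andbT -in_setU (subsetP XK).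
have cardG X : X \subset K -> #|G X| = 2 * #|X|.
  by move=> XK; rewrite card_in_imset ?cardsX ?cardsT ?card_bool 1?mulnC //; exact: injX.
have GW v : v \in G K -> v \notin W by case/imsetP=> p /fe[_ ?] ->.
have GK v : v \in G K -> v \notin K.
  by move=> /GW; apply: contra => /(subsetP AB).
have cardWG : #|W :|: G K| <= #|W| + 4 * #|A|.
  by apply: leq_trans (leq_card_setU _ _) _; rewrite cardG //; lia.
have [||||||||a1 [b1 [P [[aA bB abP] uP PW sP Pext]]]] := IH _ c1 (G A) (G B) fext.
- by move=> v; rewrite /c1; case: ifP.
- by move=> v; rewrite -GU /c1 => vG; rewrite (negPf (GK _ vG)) cW ?GW.
- move=> v; rewrite in_setU negb_or => /andP[vW vG].
  rewrite /c1 cW //; case: ifP => // vK; by rewrite (subsetP AB _ vK) in vW.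
- by rewrite -GU subsetUr.
- rewrite -setI_eq0; apply/eqP/setP => v; rewrite !inE.
  apply/negP => /andP[/imsetP[p pA ->] /imsetP[q qB]].
  move=> /finj pq; have {}pq : p = q.
    by apply: pq; move: pA qB; rewrite !inE !andbT => pA qB; rewrite ?pA ?qB ?orbT.
  move: pA qB; rewrite pq !inE !andbT => qA qB.
  by have := disjointFr dAB qA; rewrite qB.
- by rewrite !cardG // cardAB.
- by rewrite cardG // -mulnA mulnCA.
- rewrite cardG //; apply: leq_trans space; rewrite -space' leq_add2r addnA.
  by rewrite leq_add2r.
have aG : a1 \in G K by rewrite GU in_setU aA.
have bG : b1 \in G K by rewrite GU in_setU bB orbT.
move: (aA) (bB) => /imsetP[pa pA Da] /imsetP[pb pB Db].
have paA : pa.1 \in A by move: pA; rewrite !inE andbT.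
have pbB : pb.1 \in B by move: pB; rewrite !inE andbT.
have pK : pa \in setX K [set: bool] by rewrite !inE paA.
have qK : pb \in setX K [set: bool] by rewrite !inE pbB orbT.
have Z_W : G K :\: [set a1; b1] \subset W :|: G K :|: [set v in P].
  by apply/subsetP => v; rewrite !inE => /andP[_ ->]; rewrite orbT.
pose K0 := K :\: [set pa.1; pb.1].
have PnotWG v : v \in P -> v \notin W :|: G K by apply: PW.
have ext2 := rollback (K := K0) (f := f) _ _ Z_W Pext.
have sub0 : setX K0 [set: bool] \subset setX K [set: bool].
  by apply/subsetP => p; rewrite !inE !andbT => /andP[].
exists pa.1, pb.1, (a1 :: rcons P b1); split.
- split=> //=; rewrite rcons_path last_rcons abP.
  by rewrite {1}Da (proj1 (fe _ pK)) e_sym Db (proj1 (fe _ qK)).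
- rewrite /= rcons_uniq mem_rcons inE negb_or uP.
  have -> : a1 \notin P.
    by apply/negP => /PnotWG; rewrite in_setU aG orbT.
  have -> : b1 \notin P.
    by apply/negP => /PnotWG; rewrite in_setU bG orbT.
  rewrite !andbT; apply/eqP => ab; move: paA pbB.
  have -> : pa = pb by apply: finj; rewrite -?Da -?Db.
  by move=> pbA; have := disjointFr dAB pbA => ->.
- move=> v; rewrite inE mem_rcons inE => /orP[/eqP->|/orP[/eqP->|/PnotWG]].
  + exact: GW.
  + exact: GW.
  + by rewrite in_setU negb_or => /andP[].
- by rewrite /= size_rcons mulnS.
have -> : W :|: [set v in a1 :: rcons P b1] =
    (W :|: G K :|: [set v in P]) :\: (G K :\: [set a1; b1]).
  apply/setP => v; rewrite !inE mem_rcons inE.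
  have [vP|vP] := boolP (v \in P).
    by move: (PnotWG v vP); rewrite in_setU negb_or => /andP[_ /negPf->]; rewrite !orbT andbF.
  have [vG|vG] := boolP (v \in G K); last first.
    have /negPf-> : v != a1 by apply: contraNneq vG => ->.
    have /negPf-> : v != b1 by apply: contraNneq vG => ->.
    by rewrite ?andbF; case: (v \in W).
  by rewrite (negPf (GW _ vG)) orbF !andbT negbK.
apply: extendable_le (ext2 _ _) => [v|p pX|p q pX qX].
- rewrite /c1 [v \in [:: pa.1, pb.1 & _]]inE [v \in [:: pb.1 & _]]inE.
  rewrite ![v \in _ :: _]inE mem_rcons inE [v \in K0]inE in_set2.
  have [vK|vK] := boolP (v \in K); rewrite ?andbF ?andbT ?muln0 ?addn0.
    have := c2 v; case: (v == pa.1); case: (v == pb.1) => //=; rewrite ?addn0 => le2.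
    by case: ifP => // _; rewrite muln1 (leq_trans le2) // leq_addl.
  case: eqP => [Dv|_]; first by rewrite Dv (subsetP AK _ paA) in vK.
  case: eqP => [Dv|_]; first by rewrite Dv (subsetP BK _ pbB) in vK.
  by rewrite /=; case: ifP.
- have pX' := subsetP sub0 _ pX; have [ep _] := fe p pX'; split=> //.
  rewrite !inE imset_f // andbT Da Db.
  have ne q : q \in setX K [set: bool] -> p.1 != q.1 -> f p != f q.
    by move=> qX; apply: contraNneq => /finj-> .
  by move: pX; rewrite !inE negb_or => /andP[/andP[/andP[pa1 pb1] _] _]; rewrite !negb_or !ne.
- by apply: finj; apply: (subsetP sub0).
Qed.

(** The demands of the vertices [x k] and [y k] stay equal to 2 until their turn
    comes, so that the paths are found one at a time by [connect], without any of
    them cutting off the pairs still to be joined. *)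
Lemma link_pairs (I : eqType) h (L : seq I) (x y : I -> V) W c :
  uniq L -> extendable W c -> (forall v, c v <= 2) ->
  (forall v, v \notin W -> c v = 2) ->
  {in L, forall k, [/\ c (x k) = 2, c (y k) = 2, x k \in W & y k \in W]} ->
  {in L &, injective x} -> {in L &, injective y} ->
  {in L &, forall k k', x k != y k'} ->
  m <= 2 ^ h -> #|W| + 2 * h * size L + 4 * 2 ^ h + 5 * m <= #|V| ->
  exists Q : I -> seq V,
    {in L, forall k, [/\ path e (x k) (rcons (Q k) (y k)), uniq (Q k) &
                         {in Q k, forall v, v \notin W}]} /\
    {in L &, forall k k', k != k' -> {in Q k, forall v, v \notin Q k'}}.
Proof.
elim: L W c => [|k L IH] W c uL ext c2 cW cL xinj yinj xy mh space.
  by exists (fun=> [::]).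
case/andP: uL => kL uL.
have kin : k \in k :: L by rewrite mem_head.
have Lin k' : k' \in L -> k' \in k :: L by rewrite inE orbC => ->.
have [cx cy xW yW] := cL k kin.
have h2 : 0 < 2 ^ h by rewrite expn_gt0.
rewrite /= mulnS in space.
have [|||||||a [b [P [[/set1P-> /set1P-> aPb] uP PW sP]]]] :=
  connect (h := h) (A := [set x k]) (B := [set y k]) ext c2.
- by move=> v /setUP[] /set1P->.
- exact: cW.
- by rewrite subUset !sub1set xW yW.
- by rewrite -setI_eq0; apply/eqP/setP => v; rewrite !inE; case: eqP => // ->;
    rewrite (negPf (xy k k kin kin)).
- by rewrite !cards1.
- by rewrite cards1 mul1n.
- rewrite cards1 mul1n; apply: leq_trans space.
  by rewrite leq_add2r leq_add ?leq_addr ?leq_mul2l ?leq_subr ?orbT.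
pose c' v := if v \in [:: x k, y k & P] then 0 else c v; move=> ext'.
have cardP : #|[set v in P]| <= 2 * h.
  by apply: leq_trans sP; rewrite cardsE; apply: card_size.
have cW' : #|W :|: [set v in P]| <= #|W| + 2 * h.
  by apply: leq_trans (leq_card_setU _ _) _; rewrite leq_add2l.
have [|||||||Q [Q1 Q2]] := IH _ c' uL ext' _ _ _ _ _ _ mh.
- by move=> v; rewrite /c'; case: ifP.
- move=> v; rewrite !inE negb_or => /andP[vW vP]; rewrite /c' !inE (negPf vP) orbF cW //.
  by case: eqP => [Dv|_]; [rewrite Dv xW in vW | case: eqP => // Dv; rewrite Dv yW in vW].
- move=> k' k'L; have [cx' cy' xW' yW'] := cL k' (Lin _ k'L).
  have kk' : k' != k by apply: contraNneq kL => <-.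
  have notP v : v \in W -> (v \in P) = false by move=> vW; apply/negP => /PW; rewrite vW.
  have k'in := Lin _ k'L.
  have xk : (x k' == x k) = false.
    by apply/eqP => /xinj-/(_ k'in kin) Dk; rewrite Dk eqxx in kk'.
  have yk : (y k' == y k) = false.
    by apply/eqP => /yinj-/(_ k'in kin) Dk; rewrite Dk eqxx in kk'.
  have xyk := negPf (xy k' k k'in kin); have yxk := negPf (xy k k' kin k'in).
  rewrite eq_sym in yxk.
  by split; rewrite /c' ?inE ?xW' ?yW' // ?xk ?yk ?xyk ?yxk ?notP.
- by move=> k1 k2 /Lin k1L /Lin; apply: xinj.
- by move=> k1 k2 /Lin k1L /Lin; apply: yinj.
- by move=> k1 k2 /Lin k1L /Lin; apply: xy.
- apply: leq_trans space; rewrite !leq_add2r addnA leq_add2r.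
  exact: cW'.
exists (fun k' => if k' == k then P else Q k'); split.
  move=> k'; rewrite inE; case: (eqVneq k' k) => [->|kk'] //= k'L.
  have [p u d] := Q1 k' k'L; split=> // v /d; by rewrite in_setU negb_or => /andP[].
have PQ k' v : k' \in L -> v \in Q k' -> v \notin P.
  move=> k'L vQ; have [_ _ /(_ v vQ)] := Q1 k' k'L.
  by rewrite in_setU inE negb_or => /andP[].
move=> k1 k2; rewrite !inE; case: (eqVneq k1 k) => [->|k1k]; case: (eqVneq k2 k) => [->|k2k] //=.
- by move=> _ k2L _ v vP; apply/negP => /(PQ _ _ k2L); rewrite vP.
- by move=> k1L _ _ v; apply: PQ.
- exact: Q2.
Qed.

End Linking.

(** * Adjacency in lifts of a complete graph *)

Section LiftAdjacency.
Import mathcomp.boot.fintype mathcomp.boot.finset.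
Variables (n l : nat).
Local Notation Kn := (@complete_graph n).
Implicit Types (s : lift_of Kn l).

Lemma edge_proof (u v : 'I_n) : u < v -> (u < v) && Kn u v.
Proof. by move=> uv; rewrite uv /complete_graph neq_ltn uv. Qed.

Definition edge_of (u v : 'I_n) (uv : u < v) : edge Kn :=
  exist _ (u, v) (edge_proof uv).

Lemma lift_adjE s (u v : 'I_n) (uv : u < v) (i j : 'I_l) :
  lift_adj s (u, i) (v, j) = (s (edge_of uv) i == j).
Proof.
apply/existsP/eqP => [[[[u' v'] /= a]]|<-]; last first.
  by exists (edge_of uv); rewrite /= !eqxx.
have /andP[uv' _] := a.
case/orP => /and3P[/eqP Du /eqP Dv /eqP Dj]; last first.
  by move: uv uv'; rewrite Du Dv => h1 h2; have := ltn_trans h1 h2; rewrite ltnn.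
subst u' v'; rewrite Dj; congr (s _ i).
exact: val_inj.
Qed.

Lemma lift_adj_sym s : symmetric (lift_adj s).
Proof.
move=> x y; apply/existsP/existsP => -[[[u v] /= a]] xy; exists (exist _ (u, v) a) => /=;
  by rewrite orbC.
Qed.

Lemma lift_adj_fiber s x y : lift_adj s x y -> x.1 != y.1.
Proof.
case/existsP => -[[u v] /= a]; have /andP[uv _] := a.
by case/orP => /and3P[/eqP-> /eqP-> _]; rewrite neq_ltn uv ?orbT.
Qed.

Lemma lift_adj_inj s x y z :
  lift_adj s x y -> lift_adj s x z -> y.1 = z.1 -> y = z.
Proof.
case: x y z => [u i] [v j] [w k] /= xy xz vw; subst w.
have /= := lift_adj_fiber xy; rewrite neq_ltn => /orP[uv|vu].
  by move: xy xz; rewrite !lift_adjE => /eqP-> /eqP->.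
move: xy xz; rewrite ![lift_adj s (u, i) _]lift_adj_sym !lift_adjE => /eqP <- /eqP.
by move/perm_inj->.
Qed.

(** The first vertices of the [m - 1] paths that leave a given branch vertex are
    distinct neighbours of it, so they lie in distinct fibers, all different from
    its own. *)
Lemma topological_clique_lift s m :
  has_topological_clique (lift_adj s) m -> m <= n.
Proof.
case: m => // m [b [P [b_inj bP bnP disj]]].
pose first j := head (b j) (P ord0 j).
pose F (j : 'I_m.+1) := if j == ord0 then (b ord0).1 else (first j).1.
have pos (j : 'I_m.+1) : j != ord0 -> @ord0 m < j by rewrite lt0n.
have adj j : j != ord0 -> lift_adj s (b ord0) (first j).
  by move=> /pos /bP[]; rewrite /first; case: (P ord0 j) => [|y p] /= /andP[].
suff Finj : injective F by have := leq_card _ Finj; rewrite !card_ord.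
have first0 j : j != ord0 -> (b ord0).1 != (first j).1.
  by move=> /adj /lift_adj_fiber.
move=> j j'; rewrite /F; case: (eqVneq j ord0) => [->|j0];
  case: (eqVneq j' ord0) => [->|j'0] //.
- by move=> /eqP; rewrite (negPf (first0 _ j'0)).
- by move=> /esym/eqP; rewrite (negPf (first0 _ j0)).
move=> /(lift_adj_inj (adj _ j0) (adj _ j'0)).
have nb i k : i != ord0 -> b k \notin P ord0 i by move=> /pos; apply: bnP.
have head_in i x : (x \in P ord0 i -> False) -> head (b i) (P ord0 i) = x -> x = b i.
  by case: (P ord0 i) => [|y p] //= nin Dx; case: nin; rewrite Dx mem_head.
rewrite /first.
case Dp: (P ord0 j) => [|y p] /=.
  move=> E; apply: b_inj; apply: (head_in j' _ _ (esym E)).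
  by move=> h; move/negP: (nb j' j j'0).
move=> yE; have yj : y \in P ord0 j by rewrite Dp mem_head.
case Dp': (P ord0 j') => [|y' p'] in yE.
  by move: yj; rewrite yE; move/negPf: (nb j j' j0) => ->.
have y'j : y \in P ord0 j' by rewrite Dp' yE mem_head.
apply/eqP; apply: contraT => /eqP jj'.
have := disj ord0 j ord0 j' (pos _ j0) (pos _ j'0) _ y yj.
by rewrite y'j => -[] // [].
Qed.

Lemma hajos_number_lift s :
  has_topological_clique (lift_adj s) n -> hajos_number (lift_adj s) = n.
Proof.
move=> cl; rewrite /hajos_number; case: ex_maxnP => m /asboolP cm max.
apply/eqP; rewrite eqn_leq (topological_clique_lift cm) max //.
exact/asboolP.
Qed.

End LiftAdjacency.

(** * Normalised lifts and the assembly of the clique *)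

Section Normalisation.
Import mathcomp.boot.fintype mathcomp.boot.finset.
Variables (n' l : nat).
Local Notation n := n'.+1.
Local Notation Kn := (@complete_graph n).
Implicit Types (s t : lift_of Kn l).

(** The matching between the fibers over 0 and [v]; the identity if [v] is 0. *)
Definition root_perm s (v : 'I_n) : {perm 'I_l} :=
  if insub (ord0, v) is Some a then s a else 1%g.

Lemma root_permE s (v : 'I_n) (v0 : @ord0 n' < v) : root_perm s v = s (edge_of v0).
Proof.
rewrite /root_perm insubT ?edge_proof // => a; congr (s _); exact: val_inj.
Qed.

(** The matchings at the fiber over 0 are kept, and the others are written in the
    coordinates in which those would be identities. The matchings at 0 are not
    replaced by identities because this would destroy injectivity, by which the
    normalised lift is again uniformly distributed. *)
Definition normalise s : lift_of Kn l := [ffun a : edge Kn =>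
  if (val a).1 == ord0 then s a
  else root_perm s (val a).1 * s a * (root_perm s (val a).2)^-1]%g.

Lemma normalise_inj : injective normalise.
Proof.
move=> s t /ffunP st.
have root v : root_perm s v = root_perm t v.
  rewrite /root_perm; case: insubP => // a _ Da.
  by have := st a; rewrite !ffunE Da.
apply/ffunP => a; have := st a; rewrite !ffunE; case: ifP => // _.
by rewrite !root => /mulIg/mulgI.
Qed.

Definition relabel s (x : 'I_n * 'I_l) := (x.1, root_perm s x.1 x.2).

Lemma relabel_inj s : injective (relabel s).
Proof. by move=> [u i] [v j] [-> /perm_inj->]. Qed.

Lemma relabel_adj s x y : x.1 != ord0 -> y.1 != ord0 ->
  lift_adj (normalise s) x y -> lift_adj s (relabel s x) (relabel s y).
Proof.
wlog xy : x y / x.1 < y.1.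
  move=> hw x0 y0 e_xy; have := lift_adj_fiber e_xy; rewrite neq_ltn => /orP[xy|yx].
    exact: hw.
  by rewrite lift_adj_sym; apply: hw => //; rewrite lift_adj_sym.
case: x y xy => [u i] [v j] /= uv u0 v0.
rewrite !lift_adjE ffunE /= (negPf u0) => /eqP <-.
by rewrite !permM permKV.
Qed.

Lemma relabel_root s (v : 'I_n) i :
  v != ord0 -> lift_adj s (ord0, i) (relabel s (v, i)).
Proof.
move=> v0; have v_gt0 : @ord0 n' < v by rewrite lt0n.
by rewrite /relabel /= lift_adjE root_permE.
Qed.

End Normalisation.

Section Assembly.
Import mathcomp.boot.fintype mathcomp.boot.finset.
Variables (n' l : nat).
Local Notation n := n'.+1.
Local Notation Kn := (@complete_graph n).
Hypothesis nl : n <= l.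

Definition label (i : 'I_n) : 'I_l := widen_ord nl i.

(** The fiber over 0 and the terminals, in normalised coordinates. *)
Definition reserved : {set 'I_n * 'I_l} :=
  [set x : 'I_n * 'I_l | (x.1 == ord0) || (x.2 < n)].

Lemma label_inj : injective label.
Proof. by move=> i j /(congr1 val) /= /val_inj. Qed.

Variables (s : lift_of Kn l).
Local Notation t := (normalise s).
Local Notation e := (lift_adj t).

(** [phi i] assigns to the row [j] the fiber of the terminal from which the path
    from row [i] to row [j] starts. *)
Definition unmatched (phi : 'I_n -> {perm 'I_n}) : {set 'I_n * 'I_n} :=
  [set p : 'I_n * 'I_n | (p.1 < p.2) && ~~ e (phi p.1 p.2, label p.1) (phi p.2 p.1, label p.2)].

(** The reserved vertices form an extendable set with demand 2 outside the fiber
    over 0, so [link_pairs] joins the unmatched pairs of terminals. The paths of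
    the clique run from [(0, i)] to a terminal of row [i], then along an edge or a
    path of spare vertices to a terminal of row [j], then to [(0, j)]. *)
Lemma clique_of_pairing m h (phi : 'I_n -> {perm 'I_n}) :
  (forall i, phi i i = ord0) -> joined e m -> 0 < m -> m <= 2 ^ h ->
  (forall U : {set 'I_n * 'I_l}, #|U| <= m.*2 ->
     2 * #|U :\: [set x : 'I_n * 'I_l | x.1 == ord0]| <= #|nbhd e U :\: reserved|) ->
  #|reserved| + 2 * h * #|unmatched phi| + 4 * 2 ^ h + 5 * m <= n * l ->
  has_topological_clique (lift_adj s) n.
Proof.
move=> phi0 Jm m0 mh expand space.
have phiN i j : i != j -> phi i j != ord0.
  by apply: contraNneq; rewrite -(phi0 i) => /perm_inj->.
pose c (v : 'I_n * 'I_l) := if v.1 == ord0 then 0 else 2.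
have ext : extendable e m reserved c.
  move=> U /expand; apply: leq_trans.
  rewrite mulnC -sum_nat_const [leqRHS]big_mkcond [leqLHS]big_mkcond leq_sum // => v _.
  by rewrite !inE /c; case: (v.1 == ord0); case: (v \in U).
pose x (p : 'I_n * 'I_n) := (phi p.1 p.2, label p.1).
pose y (p : 'I_n * 'I_n) := (phi p.2 p.1, label p.2).
have xinj : injective x.
  move=> [i j] [i' j'] /eqP; rewrite xpair_eqE /= => /andP[+ /eqP/label_inj Di].
  by rewrite Di => /eqP/perm_inj->.
have yinj : injective y.
  move=> [i j] [i' j'] /eqP; rewrite xpair_eqE /= => /andP[+ /eqP/label_inj Di].
  by rewrite Di => /eqP/perm_inj->.
have xy (p q : 'I_n * 'I_n) : p.1 < p.2 -> q.1 < q.2 -> x p != y q.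
  move=> lp lq; apply/eqP => /eqP; rewrite xpair_eqE /= => /andP[+ /eqP/label_inj pq].
  rewrite pq => /eqP/perm_inj qp.
  by move: lp lq; rewrite pq qp => h1 h2; have := ltn_trans h1 h2; rewrite ltnn.
have x0 (p : 'I_n * 'I_n) : p.1 < p.2 -> (x p).1 != ord0 by move=> lp; rewrite phiN // neq_ltn lp.
have y0 (p : 'I_n * 'I_n) : p.1 < p.2 -> (y p).1 != ord0 by move=> lp;
  rewrite phiN // neq_ltn lp orbT.
have xW p : x p \in reserved by rewrite inE /= ltn_ord orbT.
have yW p : y p \in reserved by rewrite inE /= ltn_ord orbT.
have unmP (p : 'I_n * 'I_n) : p \in enum (unmatched phi) -> p.1 < p.2.
  by rewrite mem_enum inE => /andP[].
have [||||||||Q [Q1 Q2]] := link_pairs (h := h) (x := x) (y := y)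
    (lift_adj_sym t) Jm m0 (enum_uniq (mem (unmatched phi))) ext.
- by move=> v; rewrite /c; case: ifP.
- by move=> v; rewrite inE negb_or /c => /andP[/negPf->].
- by move=> p /unmP lp; rewrite /c (negPf (x0 _ lp)) (negPf (y0 _ lp)).
- by move=> p q _ _ /xinj.
- by move=> p q _ _ /yinj.
- by move=> p q /unmP lp /unmP; apply: xy.
- exact: mh.
- by rewrite -cardE card_prod !card_ord.
pose core p := if p \in enum (unmatched phi) then Q p else [::].
have coreW p v : v \in core p -> v \notin reserved.
  by rewrite /core; case: ifP => // /Q1[_ _ QW] /QW.
have core_path (p : 'I_n * 'I_n) : p.1 < p.2 -> path e (x p) (rcons (core p) (y p)).
  move=> lp; rewrite /core; case: ifP => [/Q1[]//|].
  by rewrite mem_enum inE lp /= => /negbFE->.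
have core_uniq p : uniq (core p) by rewrite /core; case: ifP => // /Q1[].
have core_disj p q v : p != q -> v \in core p -> v \notin core q.
  by rewrite /core; case: ifP => // pL; case: ifP => // qL pq; apply: Q2.
pose full p := x p :: rcons (core p) (y p).
have fullP p v : v \in full p -> [\/ v = x p, v = y p | v \in core p].
  by rewrite inE mem_rcons inE => /or3P[/eqP|/eqP|];
    [constructor 1|constructor 2|constructor 3] => //.
have full0 (p : 'I_n * 'I_n) v : p.1 < p.2 -> v \in full p -> v.1 != ord0.
  move=> lp /fullP[->|->|/coreW]; [exact: x0|exact: y0|].
  by rewrite inE negb_or => /andP[].
have NW v p : v \in reserved -> v \notin core p.
  by move=> vW; apply/negP => /coreW; rewrite vW.
exists (fun i => (ord0, label i)), (fun i j => map (relabel s) (full (i, j))); split.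
- by move=> i j /eqP; rewrite xpair_eqE eqxx /= => /eqP/label_inj.
- move=> i j ij; split; last first.
    rewrite (map_inj_uniq (@relabel_inj _ _ s)) /= rcons_uniq mem_rcons inE.
    by rewrite negb_or xy // !NW // core_uniq.
  have ij0 : i != j by rewrite neq_ltn ij.
  rewrite rcons_path /= map_rcons last_rcons -map_rcons.
  rewrite {1}/x [lift_adj s (ord0, label i) _]relabel_root ?phiN //=.
  rewrite lift_adj_sym [lift_adj s (ord0, label j) _]relabel_root ?phiN 1?eq_sym // andbT.
  have := core_path (i, j) ij; apply: (homo_path_in (P := [pred v | v.1 != ord0])).
    by move=> u v; rewrite !inE; apply: relabel_adj.
  by apply/allP => v; apply: full0.
- move=> i j k ij; apply/mapP => -[v /full0-/(_ ij) v0 [Dv _]].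
  by rewrite -Dv eqxx in v0.
move=> i j i' j' ij ij' pq _ /mapP[v vp ->].
rewrite (mem_map (@relabel_inj _ _ s)); apply/negP => vq.
have {}pq : (i, j) != (i', j') by apply/eqP.
case: (fullP _ _ vp) => [Dv|Dv|vc].
- case: (fullP _ _ vq) => [Dv'|Dv'|/coreW]; last by rewrite Dv xW.
    by move: pq; rewrite -(inj_eq xinj) -Dv -Dv' eqxx.
  by have := xy (i, j) (i', j') ij ij'; rewrite -Dv -Dv' eqxx.
- case: (fullP _ _ vq) => [Dv'|Dv'|/coreW]; last by rewrite Dv yW.
    by have := xy (i', j') (i, j) ij' ij; rewrite -Dv -Dv' eqxx.
  by move: pq; rewrite -(inj_eq yinj) -Dv -Dv' eqxx.
case: (fullP _ _ vq) => [Dv'|Dv'|vc'].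
- by have := coreW _ _ vc; rewrite Dv' xW.
- by have := coreW _ _ vc; rewrite Dv' yW.
- by have := core_disj _ _ _ pq vc; rewrite vc'.
Qed.

End Assembly.

(** * Joining most pairs of rows by single edges *)

Section Pairing.
Import mathcomp.boot.fintype mathcomp.boot.finset.
Variables (n' l : nat).
Local Notation n := n'.+1.
Local Notation Kn := (@complete_graph n).
Hypothesis nl : n <= l.
Implicit Types (M R : {set 'I_n * 'I_n}).

(** [M] is a graph on the rows, and [R] consists of pairs [(v, i)] standing for
    terminals: in each row as many terminals are free as there are partners. *)
Definition demand M R : Prop :=
  [/\ forall i j, (i, j) \in M -> (j, i) \in M,
      forall i, (i, i) \notin M &
      forall i, #|[set v | (v, i) \in R]| = #|[set j | (i, j) \in M]|].

Definition hits (t : lift_of Kn l) M R : Prop :=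
  exists i j v w, [/\ (i, j) \in M, (v, i) \in R, (w, j) \in R &
    lift_adj t (v, label nl i) (w, label nl j)].

(** Take an assignment with as few unmatched pairs as possible. Let [M] be the
    unmatched pairs and [R] the terminals assigned to them. If [M] and [R] are hit
    at rows [i] and [j] by terminals assigned to rows [j'] and [i'], then
    exchanging [j] with [j'] in row [i] and [i] with [i'] in row [j] matches the
    pair [(i, j)], and all other pairs affected were unmatched before. *)
Lemma exists_pairing (s : lift_of Kn l) q :
  (forall M R, demand M R -> q < #|M| -> hits (normalise s) M R) ->
  exists phi : 'I_n -> {perm 'I_n},
    (forall i, phi i i = ord0) /\ #|unmatched nl s phi| <= q.
Proof.
move=> hit; pose ok (phi : {ffun 'I_n -> {perm 'I_n}}) := [forall i, phi i i == ord0].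
have ok0 : ok [ffun i => tperm i ord0] by apply/forallP => i; rewrite ffunE tpermL.
case: (arg_minnP (fun phi : {ffun _ -> _} => #|unmatched nl s phi|) ok0) => phi okphi min.
have phi0 i : phi i i = ord0 by apply/eqP; apply: (forallP okphi).
exists phi; split=> //; rewrite leqNgt; apply/negP => big.
set e := lift_adj (normalise s).
pose bad (f : {ffun 'I_n -> {perm 'I_n}}) a b := ~~ e (f a b, label nl a) (f b a, label nl b).
have badC f a b : bad f a b = bad f b a by rewrite /bad /e lift_adj_sym.
pose M := [set p : 'I_n * 'I_n | (p.1 != p.2) && bad phi p.1 p.2].
pose R := [set p : 'I_n * 'I_n | (p.2, (phi p.2)^-1%g p.1) \in M].
have RP v i : (v, i) \in R -> exists2 j, (i, j) \in M & v = phi i j.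
  by rewrite inE /= => iM; exists ((phi i)^-1%g v); rewrite ?permKV.
have [||i [j [v [w [ijM /RP[j' ij'M Dv] /RP[i' ji'M Dw] ew]]]]] := hit M R.
- split.
  + by move=> i j; rewrite !inE /= eq_sym badC.
  + by move=> i; rewrite !inE eqxx.
  move=> i; rewrite -[RHS](card_imset _ (@perm_inj _ (phi i))).
  congr #|pred_of_set _|; apply/setP => v; apply/idP/imsetP.
    by rewrite 2!inE => vM; exists ((phi i)^-1%g v); rewrite ?permKV // inE.
  by move=> [j jM ->]; rewrite 2!inE /= permK; rewrite inE in jM.
- apply: leq_trans big _; rewrite subset_leq_card //.
  apply/subsetP => p; rewrite !inE => /andP[lp hb].
  by rewrite neq_ltn lp; exact: hb.
have bad_of a b : (a, b) \in M -> bad phi a b by rewrite inE => /andP[].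
have neq_of a b : (a, b) \in M -> a != b by rewrite inE => /andP[].
(* The exchange only alters values at pairs that belong to M. *)
pose psi := [ffun r => if r == i then tperm j j' * phi i else
                       if r == j then tperm i i' * phi j else phi r]%g.
have ij := neq_of _ _ ijM; have ij' := neq_of _ _ ij'M; have ji' := neq_of _ _ ji'M.
have psi_i x : psi i x = phi i (tperm j j' x) by rewrite ffunE eqxx permM.
have psi_j x : psi j x = phi j (tperm i i' x).
  by rewrite ffunE eq_sym (negPf ij) eqxx permM.
have changed a x : psi a x != phi a x -> bad phi a x.
  have [->|ai] := eqVneq a i.
    rewrite psi_i; case: tpermP => [-> _|-> _|_ _]; rewrite ?eqxx //; exact: bad_of.
  have [->|aj] := eqVneq a j.
    rewrite psi_j; case: tpermP => [-> _|-> _|_ _]; rewrite ?eqxx //.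
      by rewrite badC; apply: bad_of.
    exact: bad_of.
  by rewrite ffunE (negPf ai) (negPf aj) eqxx.
have better a b : bad psi a b -> bad phi a b.
  move=> badab; apply: contraT => good.
  have E1 : psi a b = phi a b by apply/eqP; apply: contraNT good; apply: changed.
  have E2 : psi b a = phi b a.
    by apply/eqP; rewrite badC in good; apply: contraNT good; apply: changed.
  by move: badab good; rewrite /bad E1 E2 => ->.
have fixed : ~~ bad psi i j.
  by rewrite /bad negbK psi_i psi_j !tpermL -Dv -Dw.
have okpsi : ok psi.
  apply/forallP => r; have [->|ri] := eqVneq r i.
    by rewrite psi_i tpermD ?phi0 // eq_sym.
  have [->|rj] := eqVneq r j; first by rewrite psi_j tpermD ?phi0 // eq_sym.
  by rewrite ffunE (negPf ri) (negPf rj) phi0.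
have := min psi okpsi; rewrite leqNgt => /negP; apply.
apply: proper_card; apply/properP; split.
  by apply/subsetP => p; rewrite !inE => /andP[-> /better].
move: ij; rewrite neq_ltn => /orP[ij|ji].
  exists (i, j); rewrite !inE ij /=; first exact: bad_of.
  by move: fixed; rewrite /bad.
exists (j, i); rewrite !inE ji /=; first by have := bad_of _ _ ijM; rewrite badC.
by move: fixed; rewrite badC /bad.
Qed.

End Pairing.

(** * Permutations with restricted images *)

Section CountingPermutations.
Import mathcomp.boot.fintype mathcomp.boot.finset.
Variable T : finType.
Implicit Types (X B : {set T}) (S : {set {perm T}}).

Definition trace X (s : {perm T}) : {ffun 'I_#|X| -> T} :=
  [ffun k => s (enum_val k)].

(** Two permutations that agree on [X] differ by a permutation of the complement
    of [X]. *)
Lemma card_by_trace X S : #|S| <= #|trace X @: S| * (#|T| - #|X|)`!.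
Proof.
rewrite -sum1_card (partition_big_imset (trace X)) /= -sum_nat_const.
apply: leq_sum => g /imsetP[s0 s0S Dg].
rewrite sum1_card.
have -> : #|T| - #|X| = #|~: X| by rewrite [RHS]cardsCs setCK.
rewrite -card_perm -(card_imset _ (mulIg s0^-1%g)) subset_leq_card //.
apply/subsetP => _ /imsetP[s /andP[sS /eqP Ds] ->]; rewrite unfold_in.
apply/subsetP => x; rewrite !inE permM; apply: contraNN => xX.
have /ffunP/(_ (enum_rank_in xX x)) : trace X s = trace X s0 by rewrite Ds Dg.
by rewrite !ffunE enum_rankK_in // => ->; rewrite permK.
Qed.

Lemma card_perm_family X (B : T -> {set T}) :
  #|[set s : {perm T} | [forall x in X, s x \in B x]]| <=
  (\prod_(x in X) #|B x|) * (#|T| - #|X|)`!.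
Proof.
apply: leq_trans (card_by_trace X _) _; rewrite leq_mul2r; apply/orP; right.
rewrite big_enum_val /=.
have -> : \prod_(k < #|X|) #|B (enum_val k)| =
    #|family (fun k : 'I_#|X| => mem (B (enum_val k)))|.
  by rewrite card_family foldrE big_map big_enum.
apply: subset_leq_card; apply/subsetP => _ /imsetP[s + ->]; rewrite inE => /forall_inP sB.
by apply/familyP => k; rewrite ffunE; apply: sB; apply: enum_valP.
Qed.

Lemma ffact_ratio b N x : b <= N -> b ^_ x * N ^ x <= N ^_ x * b ^ x.
Proof.
move=> bN; elim: x => // x IH; rewrite !ffactnSr !expnSr.
rewrite mulnACA [leqRHS]mulnACA leq_mul // !mulnBl [b * N]mulnC leq_sub2l //.
by rewrite leq_mul2l bN orbT.
Qed.

(** The probability that all of [X] is mapped into [B] is at most what it would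
    be if the images were independent. *)
Lemma card_perm_into X B :
  #|[set s : {perm T} | [forall x in X, s x \in B]]| * #|T| ^ #|X| <=
  (#|T|)`! * #|B| ^ #|X|.
Proof.
have XT : #|X| <= #|T| by apply: max_card.
have le : #|[set s : {perm T} | [forall x in X, s x \in B]]| <=
    #|B| ^_ #|X| * (#|T| - #|X|)`!.
  apply: leq_trans (card_by_trace X _) _; rewrite leq_mul2r; apply/orP; right.
  rewrite -[X in _ ^_ X]card_ord -card_inj_ffuns_on.
  apply: subset_leq_card; apply/subsetP => _ /imsetP[s + ->]; rewrite !inE => /forall_inP sB.
  apply/andP; split.
    by apply/ffun_onP => k; rewrite ffunE; apply: sB; apply: enum_valP.
  by apply/injectiveP => k k'; rewrite !ffunE => /perm_inj/enum_val_inj.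
apply: leq_trans (leq_mul le (leqnn _)) _.
rewrite -(ffact_fact XT) mulnAC [leqRHS]mulnAC leq_mul2r ffact_ratio ?orbT //.
exact: max_card.
Qed.

End CountingPermutations.

(** * The uniform measure on lifts *)

Section Probability.
Import mathcomp.boot.fintype mathcomp.boot.finset.
Local Open Scope ring_scope.
Variables (R : realType) (n l : nat).
Local Notation Kn := (@complete_graph n).
Local Notation V := ('I_n * 'I_l)%type.
Implicit Types (A : {set lift_of Kn l}) (X Y : {set V}).

Definition pr A : R := #|A|%:R / #|lift_of Kn l|%:R.

Definition perm_frac (C : {set {perm 'I_l}}) : R := #|C|%:R / (l`!)%:R.

Lemma card_lift_gt0 : 0 < #|lift_of Kn l|%:R :> R.
Proof. by rewrite ltr0n; apply/card_gt0P; exists [ffun=> 1%g]. Qed.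

Lemma fact_gt0r : 0 < (l`!)%:R :> R.
Proof. by rewrite ltr0n fact_gt0. Qed.

Lemma pr_ge0 A : 0 <= pr A.
Proof. by rewrite divr_ge0. Qed.

Lemma pr_le A A' : A \subset A' -> pr A <= pr A'.
Proof.
by move=> AA'; rewrite ler_pM2r ?invr_gt0 ?card_lift_gt0 // ler_nat subset_leq_card.
Qed.

Lemma pr_setU A A' : pr (A :|: A') <= pr A + pr A'.
Proof.
rewrite -mulrDl ler_pM2r ?invr_gt0 ?card_lift_gt0 // -natrD ler_nat.
exact: leq_card_setU.
Qed.

Lemma pr_union_bound (I : finType) (P : pred I) (A : I -> {set lift_of Kn l})
    (D : {set lift_of Kn l}) :
  (forall t, t \in D -> exists2 i, P i & t \in A i) ->
  pr D <= \sum_(i | P i) pr (A i).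
Proof.
move=> cover; rewrite -mulr_suml ler_pM2r ?invr_gt0 ?card_lift_gt0 //.
rewrite -natr_sum ler_nat.
apply: (@leq_trans #|\bigcup_(i | P i) A i|).
  apply: subset_leq_card; apply/subsetP => t /cover[i Pi tA].
  by apply/bigcupP; exists i.
elim/big_rec2: _ => [|i m B _ le]; first by rewrite cards0.
by apply: leq_trans (leq_card_setU _ _) _; rewrite leq_add2l.
Qed.

Lemma pr_setC A : pr (~: A) = 1 - pr A.
Proof.
apply/eqP; rewrite eq_sym subr_eq -mulrDl -natrD addnC.
by rewrite cardsC mulfV // gt_eqF ?card_lift_gt0.
Qed.

Lemma pr_box (C : edge Kn -> {set {perm 'I_l}}) :
  pr [set t : lift_of Kn l | [forall a : edge Kn, t a \in C a]] = \prod_a perm_frac (C a).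
Proof.
rewrite /pr /perm_frac big_split /= prodfV; congr (_ / _).
  rewrite -natr_prod; congr (_%:R).
  have -> : (\prod_a #|C a|)%N = #|family (fun a => mem (C a))|.
    by rewrite card_family foldrE big_map big_enum.
  rewrite cardsE; apply: eq_card => t; rewrite inE.
  by apply/forallP/familyP.
rewrite card_ffun prodr_const -natrX; congr ((_ ^ _)%:R).
by rewrite card_Sn.
Qed.

Lemma prod_edge (F : 'I_n -> 'I_n -> R) :
  \prod_(a : edge Kn) F (val a).1 (val a).2 = \prod_(u : 'I_n) \prod_(v : 'I_n | (u < v)%N) F u v.
Proof.
rewrite pair_big_dep /=.
have inj : {in xpredT : pred (edge Kn) &, injective val} by move=> a b _ _ /val_inj.
rewrite -(big_imset (fun p : 'I_n * 'I_n => F p.1 p.2) inj) /=.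
apply: eq_bigl => p; apply/imsetP/idP => [[[q /= /andP[qP _]] _ ->] //|].
by case: p => u v uv; exists (edge_of uv).
Qed.

Definition slice X (u : 'I_n) : {set 'I_l} := [set i | (u, i) \in X].

Lemma card_slices X : (\sum_u #|slice X u|)%N = #|X|.
Proof.
rewrite -sum1_card (eq_bigr (fun u => \sum_(i | (u, i) \in X) 1)%N) => [|u _].
  by rewrite pair_big_dep; apply: eq_bigl => -[u i].
by rewrite -sum1_card; apply: eq_bigl => i; rewrite inE.
Qed.

Lemma card_slice_le X u : (#|slice X u| <= l)%N.
Proof. by rewrite -[X in (_ <= X)%N]card_ord max_card. Qed.

Definition no_edge X Y : {set lift_of Kn l} :=
  [set t : lift_of Kn l | [forall x in X, forall y in Y, ~~ lift_adj t x y]].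

Lemma perm_frac_le (C C' : {set {perm 'I_l}}) :
  C \subset C' -> perm_frac C <= perm_frac C'.
Proof.
by move=> CC; rewrite ler_pM2r ?invr_gt0 ?fact_gt0r // ler_nat subset_leq_card.
Qed.

Lemma perm_frac_avoid (X Y : {set 'I_l}) : (0 < l)%N ->
  perm_frac [set s : {perm 'I_l} | [forall i in X, s i \notin Y]] <=
  (1 - #|Y|%:R / l%:R) ^+ #|X|.
Proof.
move=> l0; have l0r : 0 < l%:R :> R by rewrite ltr0n.
rewrite ler_pdivrMr ?fact_gt0r //.
have -> : 1 - #|Y|%:R / l%:R = #|~: Y|%:R / l%:R :> R.
  rewrite [#|~: Y|]cardsCs setCK card_ord natrB; last first.
    by rewrite -[X in (_ <= X)%N]card_ord max_card.
  by rewrite mulrBl divff ?gt_eqF.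
rewrite expr_div_n mulrAC ler_pdivlMr ?exprn_gt0 // -!natrX -!natrM ler_nat.
have := card_perm_into X (~: Y); rewrite card_ord [leqRHS]mulnC.
apply: leq_trans; rewrite leq_mul2r; apply/orP; right; apply: subset_leq_card.
apply/subsetP => s; rewrite !inE => /forall_inP sY; apply/forall_inP => i /sY.
by rewrite inE.
Qed.

(** Let [x_w] and [y_w] be the sizes of the slices. An edge [uv] of the complete
    graph gives two constraints on one permutation, of probabilities at most
    [(1 - y_v / l) ^ x_u] and [(1 - y_u / l) ^ x_v]. They are not independent, but
    the probability of both is at most the geometric mean of these bounds, whence
    the square. *)
Lemma no_edge_bound X Y : (0 < l)%N ->
  pr (no_edge X Y) ^+ 2 <=
  \prod_w (1 - #|slice Y w|%:R / l%:R) ^+ (#|X| - #|slice X w|).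
Proof.
move=> l0.
pose q w : R := 1 - #|slice Y w|%:R / l%:R.
have q_ge0 w : 0 <= q w.
  by rewrite subr_ge0 ler_pdivrMr ?ltr0n // mul1r ler_nat card_slice_le.
pose C (a : edge Kn) : {set {perm 'I_l}} :=
  [set s : {perm 'I_l} | [forall i in slice X (val a).1, s i \notin slice Y (val a).2]] :&:
  [set s : {perm 'I_l} | [forall i in slice X (val a).2, (s^-1)%g i \notin slice Y (val a).1]].
have sub : no_edge X Y \subset [set t : lift_of Kn l | [forall a : edge Kn, t a \in C a]].
  apply/subsetP => t; rewrite !inE => /forall_inP H; apply/forallP => -[[u v] a].
  have /andP[/= uv _] := a.
  have -> : exist _ (u, v) a = edge_of uv by apply: val_inj.
  rewrite !inE; apply/andP; split; apply/forall_inP => i; rewrite inE /= => iX;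
    rewrite inE; apply/negP => jY; move/forall_inP/(_ _ jY): (H _ iX).
    by rewrite lift_adjE eqxx.
  by rewrite lift_adj_sym lift_adjE permKV eqxx.
apply: le_trans (_ : (\prod_a perm_frac (C a)) ^+ 2 <= _).
  by rewrite lerXn2r ?nnegrE ?pr_ge0 ?prodr_ge0 // -?pr_box ?pr_le // => a _; rewrite divr_ge0.
have fracC a : perm_frac (C a) ^+ 2 <=
    q (val a).2 ^+ #|slice X (val a).1| * q (val a).1 ^+ #|slice X (val a).2|.
  rewrite expr2 ler_pM ?divr_ge0 //.
    by apply: le_trans (perm_frac_le (subsetIl _ _)) _; apply: perm_frac_avoid.
  apply: le_trans (perm_frac_le (subsetIr _ _)) _.
  apply: le_trans (perm_frac_avoid _ _ l0); rewrite ler_pM2r ?invr_gt0 ?fact_gt0r //.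
  rewrite ler_nat -(card_imset _ (@invg_inj _)) subset_leq_card //.
  by apply/subsetP => _ /imsetP[s + ->]; rewrite !inE.
rewrite -prodrXl; apply: le_trans (_ : \prod_(a : edge Kn)
    (q (val a).2 ^+ #|slice X (val a).1| * q (val a).1 ^+ #|slice X (val a).2|) <= _).
  by apply: ler_prod => a _; rewrite fracC exprn_ge0 // divr_ge0.
rewrite (prod_edge (fun u v => q v ^+ #|slice X u| * q u ^+ #|slice X v|)).
rewrite (eq_bigr (fun u : 'I_n => \prod_(v : 'I_n | (u < v)%N) q v ^+ #|slice X u| *
    \prod_(v : 'I_n | (u < v)%N) q u ^+ #|slice X v|)) => [|u _]; last first.
  by rewrite -big_split.
rewrite big_split /= [X in X * _](exchange_big_dep xpredT) //= -big_split /=.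
apply: ler_prod => w _; rewrite mulr_ge0 ?prodr_ge0 //=; try by move=> ? _; rewrite exprn_ge0.
rewrite !prodrXr -exprD -(card_slices X) [X in (X - _)%N](bigD1 w) //= addKn le_eqVlt;
  apply/orP; left.
apply/eqP; congr (_ ^+ _); rewrite [RHS](bigID (fun u : 'I_n => (u < w)%N)) /=.
congr (_ + _)%N; apply: eq_bigl => u.
  by rewrite neq_ltn; case: ltngtP.
by rewrite neq_ltn -leqNgt; case: ltngtP.
Qed.

End Probability.

(** * Large vertex sets are joined *)

Section Joined.
Import mathcomp.boot.fintype mathcomp.boot.finset.
Local Open Scope ring_scope.
Variables (R : realType) (n l m : nat).
Local Notation Kn := (@complete_graph n).
Local Notation V := ('I_n * 'I_l)%type.
Implicit Types (X Y : {set V}).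
Hypothesis l_gt0 : (0 < l)%N.
Local Notation pr := (@pr R n l).
Local Notation no_edge := (@no_edge n l).

Lemma slice_ratio Y w : 0 <= 1 - #|slice Y w|%:R / l%:R :> R /\
  1 - #|slice Y w|%:R / l%:R <= 1 :> R.
Proof.
split; last by rewrite gerBl divr_ge0.
by rewrite subr_ge0 ler_pdivrMr ?ltr0n // mul1r ler_nat card_slice_le.
Qed.

(** As slices have at most [l] elements, each factor of [no_edge_bound] is at most
    [expR (- (y_w / l) * (m - l))], and the [y_w] add up to at least [m]. *)
Lemma pr_no_edge_large X Y : (m <= #|X|)%N -> (m <= #|Y|)%N ->
  (8 * (n * l) * l <= m * (m - l))%N -> pr (no_edge X Y) <= 16%:R^-1 ^+ (n * l).
Proof.
move=> mX mY big; rewrite -(@ler_pXn2r _ 2) ?nnegrE ?pr_ge0 ?exprn_ge0 ?invr_ge0 //.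
apply: le_trans (no_edge_bound R X Y l_gt0) _.
apply: le_trans (_ : \prod_w expR (- (#|slice Y w|%:R / l%:R * (m - l)%:R)) <= _).
  apply: ler_prod => w _; have [q0 q1] := slice_ratio Y w.
  rewrite exprn_ge0 //=.
  apply: le_trans (_ : (1 - #|slice Y w|%:R / l%:R) ^+ (m - l) <= _).
    by rewrite ler_wiXn2l // leq_sub // card_slice_le.
  rewrite -[X in expR X]mulNr expRM_natr lerXn2r ?nnegrE ?expR_ge0 //.
  exact: expR_ge1Dx.
rewrite -expR_sum sumrN -mulr_suml -mulr_suml -natr_sum card_slices -exprM.
have l0 : 0 < l%:R :> R by rewrite ltr0n.
have h : (8 * (n * l))%:R <= #|Y|%:R / l%:R * (m - l)%:R :> R.
  rewrite mulrAC ler_pdivlMr // -!natrM ler_nat; apply: leq_trans big _.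
  by rewrite leq_mul2r mY orbT.
apply: le_trans (_ : expR (- (8 * (n * l))%:R) <= _); first by rewrite ler_expR lerN2.
rewrite expRN exprVn lef_pV2 ?posrE ?expR_gt0 ?exprn_gt0 //.
have e2 : 2 <= expR 1 :> R by apply: le_trans (expR_ge1Dx 1); rewrite lerD2l.
have -> : (8 * (n * l))%:R = 1 * (8 * (n * l))%:R :> R by rewrite mul1r.
rewrite expRM_natr; have -> : (8 * (n * l) = 4 * (n * l * 2))%N by lia.
rewrite [expR 1 ^+ _]exprM lerXn2r ?nnegrE ?exprn_ge0 ?expR_ge0 //.
apply: le_trans (_ : 2 ^+ 4 <= _); first by rewrite -natrX ler_nat.
by rewrite lerXn2r ?nnegrE ?expR_ge0.
Qed.

Lemma pr_not_joined : (8 * (n * l) * l <= m * (m - l))%N ->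
  pr [set t : lift_of Kn l | ~~ `[< joined (lift_adj t) m >]] <= 4%:R^-1 ^+ (n * l).
Proof.
move=> big.
pose big2 (XY : {set V} * {set V}) := (m <= #|XY.1|)%N && (m <= #|XY.2|)%N.
apply: le_trans (@pr_union_bound R n l _ big2 (fun XY => no_edge XY.1 XY.2) _ _) _.
  move=> t; rewrite inE => /asboolPn/existsNP[X /existsNP[Y]].
  move=> /not_implyP[mX /not_implyP[mY none]].
  exists (X, Y); first by rewrite /big2 mX mY.
  rewrite inE; apply/forall_inP => x xX; apply/forall_inP => y yY.
  by apply/negP => xy; apply: none; exists x, y.
apply: le_trans (_ : \sum_(XY : {set V} * {set V}) 16%:R^-1 ^+ (n * l) <= _).
  rewrite [leRHS](bigID big2) /= -[leLHS]addr0 lerD //.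
    by apply: ler_sum => -[X Y] /andP[mX mY]; apply: pr_no_edge_large.
  by apply: sumr_ge0 => _ _; rewrite exprn_ge0 ?invr_ge0.
rewrite sumr_const card_prod -!cardsT -powersetT card_powerset cardsT card_prod !card_ord.
rewrite -[_ *+ _]mulr_natl natrM !natrX -exprMn -exprMn le_eqVlt; apply/orP; left.
by apply/eqP; congr (_ ^+ _); lra.
Qed.

End Joined.

(** * Small vertex sets expand *)

Section Markov.
Import mathcomp.boot.fintype mathcomp.boot.finset.

Lemma card_large_values (I : finType) (f : I -> nat) b :
  #|[set i | b < f i]| * b.+1 <= \sum_i f i.
Proof.
rewrite -sum_nat_const [leqRHS](bigID (mem [set i | b < f i])) /=.
apply: leq_trans (leq_addr _ _); apply: leq_sum => i.
by rewrite inE.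
Qed.

Lemma exists_superset (T : finType) (A : {set T}) k :
  #|A| <= k <= #|T| -> exists2 B : {set T}, A \subset B & #|B| = k.
Proof.
move=> /andP[Ak kT]; pose r := take k (enum A ++ enum (~: A)).
have ur : uniq (enum A ++ enum (~: A)).
  rewrite cat_uniq !enum_uniq /= andbT; apply/hasPn => x.
  by rewrite !mem_enum inE.
exists [set x in r].
  apply/subsetP => x xA; rewrite inE /r take_cat -cardE.
  case: ltnP => kA; last by rewrite mem_cat mem_enum xA.
  by have := leq_ltn_trans Ak kA; rewrite ltnn.
rewrite cardsE (card_uniqP (take_uniq _ ur)) size_take size_cat -!cardE cardsC.
by case: ltnP => // Tk; apply/eqP; rewrite eqn_leq Tk.
Qed.

(** Every factor of the falling factorial exceeds [c]. *)
Lemma expn_le_ffact c j : c ^ j <= (c + j) ^_ j.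
Proof.
elim: j => // j IH; rewrite expnS addnS ffactSS leq_mul //.
by rewrite ltnW // ltnS leq_addr.
Qed.

Lemma ffact_le_expn N j : N ^_ j <= N ^ j.
Proof. by elim: j => // j IH; rewrite ffactnSr expnSr leq_mul // leq_subr. Qed.

Lemma bin_le_exp2 N k : 'C(N, k) <= 2 ^ N.
Proof.
elim: N k => [|N IH] [|k] //; first by rewrite bin0 expn_gt0.
by rewrite binS expnS mul2n -addnn leq_add.
Qed.

(** Since [a ^ a <= (2 a) ^_ a = 'C(2 a, a) * a`!], one has [a ^ a <= 4 ^ a * a`!]. *)
Lemma bin_le N a : 'C(N, a) * a ^ a <= (4 * N) ^ a.
Proof.
have pow_fact : a ^ a <= 4 ^ a * a`!.
  apply: leq_trans (expn_le_ffact a a) _; rewrite -bin_ffact leq_mul2r.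
  by rewrite -[4]/(2 ^ 2) -expnM mul2n -addnn bin_le_exp2 orbT.
apply: leq_trans (leq_mul (leqnn _) pow_fact) _.
by rewrite mulnCA bin_ffact expnMn leq_mul2l ffact_le_expn orbT.
Qed.

End Markov.

Section Expansion.
Import mathcomp.boot.fintype mathcomp.boot.finset.
Local Open Scope ring_scope.
Variables (R : realType) (n' l m : nat).
Local Notation n := n'.+1.
Local Notation Kn := (@complete_graph n).
Local Notation V := ('I_n * 'I_l)%type.
Implicit Types (U Y : {set V}).
Hypothesis n_le_l : (n <= l)%N.
Local Notation pr := (@pr R n l).
Local Notation no_edge := (@no_edge n l).
Local Notation reserved := (@reserved n' l).

Definition spare_outside Y : {set V} := ~: (reserved :|: Y).

(** Bounds the proportion of a typical fiber that is occupied by the terminals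
    together with an exceptional set of [2 a] vertices. *)
Definition density a : R := (n ^ 2 + 8 * a)%:R / (n * l)%:R.

(** This is the probability that the spare neighbours of [U] lie in [Y]. At most
    one fiber contains more than half of [U], and fewer than [n / 4] fibers contain
    more than four times the average share of [Y]. Each of the other fibers, at
    least [n / 2] in number, contributes a factor [density a ^ (a / 2)] to
    [no_edge_bound]. *)
Lemma pr_no_edge_spare a U Y : (8 <= n)%N -> #|U| = a -> #|Y| = (2 * a)%N ->
  density a <= 1 ->
  pr (no_edge U (spare_outside Y)) ^+ 8 <= density a ^+ (a * n).
Proof.
move=> n8 Ua Ya rho1.
have l0 : (0 < l)%N by apply: leq_trans n_le_l.
have l0r : 0 < l%:R :> R by rewrite ltr0n.
set rho := density a in rho1 *.
have rho0 : 0 <= rho by rewrite divr_ge0.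
have [->|a0] := posnP a.
  by rewrite mul0n expr0 exprn_ile1 ?pr_ge0 // ler_pdivrMr ?card_lift_gt0 // mul1r ler_nat max_card.
pose G := [set w : 'I_n | [&& w != ord0, n * #|slice Y w| <= 8 * a & 2 * #|slice U w| <= a]%N].
have cG : (n <= 2 * #|G|)%N.
  pose B1 := [set w : 'I_n | 8 * a < n * #|slice Y w|]%N.
  pose B2 := [set w : 'I_n | a < 2 * #|slice U w|]%N.
  have h1 : (#|B1| * (8 * a).+1 <= n * (2 * a))%N.
    by apply: leq_trans (card_large_values _ _) _; rewrite -big_distrr /= card_slices Ya.
  have h2 : (#|B2| * a.+1 <= 2 * a)%N.
    by apply: leq_trans (card_large_values _ _) _; rewrite -big_distrr /= card_slices Ua.
  have cover : [set: 'I_n] \subset [set ord0] :|: B1 :|: B2 :|: G.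
    apply/subsetP => w _; rewrite !inE ![(_ < _)%N]ltnNge.
    by case: (w == ord0); case: (_ <= _)%N => //=; case: (_ <= _)%N.
  have := subset_leq_card cover; rewrite cardsT card_ord => le.
  have {}le : (n <= 1 + #|B1| + #|B2| + #|G|)%N.
    apply: leq_trans le _; do 3 (apply: leq_trans (leq_card_setU _ _) _; rewrite ?leq_add2r).
    by rewrite cards1.
  have b2 : (#|B2| <= 1)%N by rewrite leqNgt; apply/negP => b2; nia.
  have b1 : (4 * #|B1| <= n)%N by rewrite leqNgt; apply/negP => b1; nia.
  by move: (#|B1|) (#|B2|) (#|G|) le b1 b2 n8; clear; lia.
have ratio w : 0 <= 1 - #|slice (spare_outside Y) w|%:R / l%:R :> R /\
    1 - #|slice (spare_outside Y) w|%:R / l%:R <= 1 :> R by apply: slice_ratio.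
have good w : w \in G -> 1 - #|slice (spare_outside Y) w|%:R / l%:R <= rho.
  rewrite inE => /and3P[w0 Yw _].
  have out : (l <= n + #|slice Y w| + #|slice (spare_outside Y) w|)%N.
    pose low : {set 'I_l} := [set i : 'I_l | (i < n)%N].
    have clow : (#|low| <= n)%N.
      have : low \subset [set label n_le_l i | i in [set: 'I_n]].
        apply/subsetP => i; rewrite inE => i_n; apply/imsetP; exists (Ordinal i_n) => //.
        exact: val_inj.
      move/subset_leq_card/leq_trans; apply; apply: leq_trans (leq_imset_card _ _) _.
      by rewrite cardsT card_ord.
    have : [set: 'I_l] \subset low :|: slice Y w :|: slice (spare_outside Y) w.
      by apply/subsetP => i _; rewrite !inE /= (negPf w0) negb_or; case: (_ < _)%N => //=;
        case: (_ \in Y).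
    move/subset_leq_card; rewrite cardsT card_ord.
    have c1 : (_ <= _)%N := leq_card_setU (low :|: slice Y w) (slice (spare_outside Y) w).
    have c2 : (_ <= _)%N := leq_card_setU low (slice Y w).
    by move: clow c1 c2; clear; lia.
  rewrite lerBlDr -lerBlDl /rho /density natrM invfM mulrA.
  rewrite -(@ler_pM2r _ l%:R) // mulrBl mul1r.
  rewrite -(mulrA _ l%:R^-1) mulVf ?gt_eqF // mulr1 -[X in _ <= X]mulrA mulVf ?gt_eqF // mulr1.
  rewrite lerBlDr -(@ler_pM2l _ n%:R) ?ltr0n // mulrDr [n%:R * (_ / _)]mulrCA mulfV ?pnatr_eq0 // mulr1.
  by rewrite -!natrM -natrD ler_nat; nia.
have step : pr (no_edge U (spare_outside Y)) ^+ 4 <= rho ^+ (a * #|G|).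
  have := no_edge_bound R U (spare_outside Y) l0.
  set P := \prod_w _ => bound.
  have P0 : 0 <= P by apply: prodr_ge0 => w _; rewrite exprn_ge0 ?(proj1 (ratio w)).
  apply: le_trans (_ : P ^+ 2 <= _).
    by rewrite (exprM _ 2 2) lerXn2r ?nnegrE ?exprn_ge0 ?pr_ge0.
  rewrite -prodrXl (bigID (mem G)) /= mulrC.
  rewrite [leRHS]exprM -[leRHS]mul1r -[X in _ <= _ * X]prodr_const.
  apply: ler_pM.
  - by apply: prodr_ge0 => w _; rewrite !exprn_ge0 ?(proj1 (ratio w)).
  - by apply: prodr_ge0 => w _; rewrite !exprn_ge0 ?(proj1 (ratio w)).
  - by apply: prodr_ile1 => w _;
      rewrite !exprn_ge0 ?exprn_ile1 ?exprn_ge0 ?(proj1 (ratio w)) ?(proj2 (ratio w)).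
  apply: ler_prod => w wG; rewrite !exprn_ge0 ?(proj1 (ratio w)) //=.
  rewrite -exprM; apply: le_trans (_ : rho ^+ ((#|U| - #|slice U w|) * 2) <= _).
    by rewrite lerXn2r ?nnegrE ?(proj1 (ratio w)) ?good.
  apply: ler_wiXn2l => //; move: wG; rewrite inE => /and3P[_ _]; rewrite Ua; lia.
rewrite (exprM _ 4 2); apply: le_trans (_ : (rho ^+ (a * #|G|)) ^+ 2 <= _).
  by rewrite lerXn2r ?nnegrE ?exprn_ge0 ?pr_ge0.
by rewrite -exprM ler_wiXn2l //; move: cG; clear; nia.
Qed.

Definition expanding (t : lift_of Kn l) : Prop := forall U : {set V},
  (#|U| <= m.*2)%N -> (2 * #|U :\: [set x : 'I_n * 'I_l | x.1 == ord0]| <=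
    #|nbhd (lift_adj t) U :\: reserved|)%N.

Lemma bin_le_r N a : (0 < a)%N -> 'C(N, a)%:R <= (4 * (N%:R / a%:R)) ^+ a :> R.
Proof.
move=> a0; rewrite mulrA expr_div_n ler_pdivlMr ?exprn_gt0 ?ltr0n //.
by rewrite -natrM -!natrX -natrM ler_nat bin_le.
Qed.

Definition spare_trap a (t : lift_of Kn l) := [exists UY : {set V} * {set V},
  [&& #|UY.1| == a, #|UY.2| == (2 * a)%N & t \in no_edge UY.1 (spare_outside UY.2)]].

(** The binomial coefficients counting [U] and [Y] amount to at most
    [16 (n l / a) ^ 3] for each element of [U]. *)
Lemma pr_spare_trap a : (8 <= n)%N -> (0 < a)%N -> density a <= 1 ->
  pr [set t | spare_trap a t] <=
  (16 * ((n * l)%:R / a%:R) ^+ 3 * density a ^+ (n %/ 8)) ^+ a.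
Proof.
move=> n8 a0 rho1.
have rho0 : 0 <= density a by rewrite divr_ge0.
pose D : {set {set V} * {set V}} :=
  setX [set U : {set V} | #|U| == a] [set Y : {set V} | #|Y| == (2 * a)%N].
apply: le_trans (@pr_union_bound R n l _ (mem D)
  (fun UY => no_edge UY.1 (spare_outside UY.2)) _ _) _.
  move=> t; rewrite inE => /existsP[[U Y] /and3P[/= Ua Ya tUY]].
  by exists (U, Y) => //; rewrite !inE Ua Ya.
apply: le_trans (_ : \sum_(UY in D) (density a ^+ (n %/ 8)) ^+ a <= _).
  apply: ler_sum => -[U Y]; rewrite !inE /= => /andP[/eqP Ua /eqP Ya].
  rewrite -(@ler_pXn2r _ 8) ?nnegrE ?pr_ge0 ?exprn_ge0 //.
  apply: le_trans (pr_no_edge_spare n8 Ua Ya rho1) _.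
  rewrite -!exprM ler_wiXn2l // -mulnA mulnC -mulnA leq_mul2l mulnC leq_trunc_div.
  by rewrite orbT.
rewrite sumr_const cardsX !card_draws card_prod !card_ord -[_ *+ _]mulr_natl.
rewrite [leRHS]exprMn ler_wpM2r ?exprn_ge0 // natrM.
have -> : 16 * ((n * l)%:R / a%:R) ^+ 3 =
    (4 * ((n * l)%:R / a%:R)) * (4 * ((n * l)%:R / (2 * a)%:R)) ^+ 2 :> R.
  rewrite [(2 * a)%:R]natrM invfM; set x := (n * l)%:R; set y := a%:R^-1.
  by field.
rewrite exprMn -exprM ler_pM ?bin_le_r // ?muln_gt0 //.
Qed.

Lemma sum_geometric_le (eta : R) k : 0 <= eta -> 2 * eta <= 1 ->
  \sum_(i < k) eta ^+ i.+1 <= 2 * eta.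
Proof.
move=> eta0 eta2; suff : \sum_(i < k) eta ^+ i.+1 + 2 * eta ^+ k.+1 <= 2 * eta.
  by apply: le_trans; rewrite lerDl mulr_ge0 ?exprn_ge0.
elim: k => [|k IH]; first by rewrite big_ord0 add0r expr1.
apply: le_trans IH; rewrite big_ord_recr /= -addrA lerD2l [X in _ + 2 * X]exprS mulrA.
rewrite [leRHS](_ : _ = eta ^+ k.+1 + 1 * eta ^+ k.+1); last by ring.
by rewrite lerD2l ler_wpM2r ?exprn_ge0.
Qed.

(** A set violating expansion has, outside the fiber over 0, fewer than twice as
    many spare neighbours as elements; they are padded to a set [Y] of exactly
    twice the size, and a geometric series bounds the sum over all sizes. *)
Lemma pr_not_expanding (eta : R) :
  (8 <= n)%N -> (0 < m)%N -> (4 * m <= n * l)%N -> density m.*2 <= 1 -> 2 * eta <= 1 ->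
  (forall a, (0 < a <= m.*2)%N ->
     16 * ((n * l)%:R / a%:R) ^+ 3 * density a ^+ (n %/ 8) <= eta) ->
  pr [set t : lift_of Kn l | ~~ `[< expanding t >]] <= 2 * eta.
Proof.
move=> n8 m0 m4 rho1 eta2 small.
have dens_le a : (a <= m.*2)%N -> density a <= 1.
  move=> am; apply: le_trans rho1; rewrite ler_wpM2r ?invr_ge0 // ler_nat.
  by rewrite leq_add2l leq_mul2l am orbT.
have eta0 : 0 <= eta.
  apply: le_trans (small 1%N _); last by rewrite double_gt0 m0.
  by rewrite mulr_ge0 ?exprn_ge0 ?mulr_ge0 ?exprn_ge0 ?divr_ge0.
apply: le_trans (@pr_union_bound R n l 'I_m.*2 xpredT (fun a => [set t | spare_trap a.+1 t]) _ _) _.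
  move=> t; rewrite inE => /asboolPn/existsNP[U /not_implyP[Um /negP]].
  rewrite -ltnNge; set U' := U :\: _ => lt.
  have U'0 : (0 < #|U'|)%N by rewrite lt0n; apply: contraTneq lt => ->.
  have U'm : (#|U'| <= m.*2)%N.
    by apply: leq_trans Um; rewrite subset_leq_card ?subsetDl.
  have U'm' : (#|U'|.-1 < m.*2)%N by rewrite prednK.
  exists (Ordinal U'm') => //; rewrite inE /spare_trap /= prednK //.
  have [|Y sub cY] := @exists_superset _ (nbhd (lift_adj t) U' :\: reserved) (2 * #|U'|).
    rewrite card_prod !card_ord; apply/andP; split; last first.
      by move: U'm m4; rewrite -muln2; clear; lia.
    apply: leq_trans (ltnW lt); apply: subset_leq_card.
    by rewrite setSD // nbhdS // subsetDl.
  apply/existsP; exists (U', Y); rewrite /= eqxx cY eqxx /=.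
  rewrite inE; apply/forall_inP => x xU; apply/forall_inP => y.
  rewrite in_setC in_setU negb_or => /andP[yW yY]; apply: contraNN yY => xy.
  by apply: (subsetP sub); rewrite in_setD yW; apply/nbhdP; exists x.
apply: le_trans (sum_geometric_le m.*2 eta0 eta2).
apply: ler_sum => a _; apply: le_trans (pr_spare_trap n8 _ _) _ => //.
  by apply: dens_le; apply: ltn_ord.
rewrite lerXn2r ?nnegrE //; last by apply: small; rewrite ltn_ord.
by rewrite mulr_ge0 ?exprn_ge0 ?mulr_ge0 ?exprn_ge0 ?divr_ge0.
Qed.

End Expansion.

(** * Unsatisfied demands are hit *)

Section DemandCount.
Import mathcomp.boot.fintype mathcomp.boot.finset.
Variables (n' D : nat).
Local Notation n := n'.+1.
Variables (M F : {set 'I_n * 'I_n}).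
Hypotheses (dem : demand M F) (M_large : 4 * D * n <= #|M|).

Definition degree (i : 'I_n) := #|[set j : 'I_n | (i, j) \in M]|.
Definition free_at (i : 'I_n) : {set 'I_n} := [set v : 'I_n | (v, i) \in F].
Definition wanted (w i : 'I_n) : {set 'I_n} :=
  [set j : 'I_n | ((i, j) \in M) && ((w, j) \in F)].

Let busy (i : 'I_n) := D <= degree i.

(** Rows of degree less than [D] account for at most [2 D n] ordered pairs. *)
Lemma card_busy_pairs :
  2 * D * n <= \sum_i \sum_j [&& (i, j) \in M, busy i & busy j].
Proof.
have [Msym Mirr MF] := dem.
have cM : #|M| = \sum_i \sum_j ((i, j) \in M).
  rewrite -sum1_card pair_big /= big_mkcond /=; apply: eq_bigr => -[i j] _.
  by case: (_ \in _).
pose light := \sum_i \sum_j ((i, j) \in M) && ~~ busy i.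
have light_le : light <= n * D.
  rewrite /light -[X in X * D]card_ord -sum_nat_const; apply: leq_sum => i _.
  rewrite /busy; case: (leqP D (degree i)) => [_|lt].
    by rewrite big1 // => j _; rewrite andbF.
  apply: leq_trans (ltnW lt); rewrite /degree -sum1_card big_mkcond /=.
  by rewrite [leqRHS]big_mkcond; apply: leq_sum => j _; rewrite inE andbT; case: (_ \in _).
have light' : \sum_i \sum_j ((i, j) \in M) && ~~ busy j = light.
  rewrite /light exchange_big; apply: eq_bigr => i _; apply: eq_bigr => j _.
  by have -> : ((j, i) \in M) = ((i, j) \in M) by apply/idP/idP => /Msym.
have : #|M| <= \sum_i \sum_j [&& (i, j) \in M, busy i & busy j] + light +
    \sum_i \sum_j ((i, j) \in M) && ~~ busy j.
  rewrite cM /light -!big_split leq_sum // => i _ /=; rewrite -!big_split leq_sum // => j _ /=.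
  by case: (_ \in _); case: (busy i); case: (busy j).
by rewrite light'; move: light_le M_large; clear; nia.
Qed.

Let f (v w i j : 'I_n) : nat := [&& (i, j) \in M, (v, i) \in F & (w, j) \in F].

(** The number of potential edges between free terminals that would hit the
    demand, with the fibers [v < w] in increasing order. Exchanging the two ends
    shows that these are half of those with [v <> w], and every pair of busy rows
    has at least [D (D - 1)] of the latter. *)
Lemma sum_demand_lt :
  D ^ 2 * (D - 1) * n <= \sum_(v : 'I_n) \sum_(w : 'I_n) \sum_i \sum_j (v < w) * f v w i j.
Proof.
have [Msym Mirr MF] := dem.
set S := \sum_v _.
have Sgt : \sum_(v : 'I_n) \sum_(w : 'I_n) \sum_i \sum_j (w < v) * f v w i j = S.
  rewrite exchange_big; apply: eq_bigr => v _; apply: eq_bigr => w _.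
  rewrite exchange_big; apply: eq_bigr => i _; apply: eq_bigr => j _.
  congr (_ * nat_of_bool _).
  have -> : ((j, i) \in M) = ((i, j) \in M) by apply/idP/idP => /Msym.
  by rewrite [((w, j) \in F) && _]andbC.
have S2 : \sum_i \sum_j \sum_(v : 'I_n) \sum_(w : 'I_n) (v != w) * f v w i j = S + S.
  rewrite -{2}Sgt /S -big_split /=.
  rewrite (eq_bigr (fun i => \sum_(v : 'I_n) \sum_(w : 'I_n) \sum_j (v != w) * f v w i j));
    last first.
    move=> i _; rewrite exchange_big; apply: eq_bigr => v _; exact: exchange_big.
  rewrite exchange_big; apply: eq_bigr => v _.
  rewrite exchange_big -big_split; apply: eq_bigr => w _ /=.
  rewrite -big_split; apply: eq_bigr => i _ /=; rewrite -big_split; apply: eq_bigr => j _ /=.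
  by rewrite -mulnDl neq_ltn; case: ltngtP.
suff : 2 * D * n * (D * (D - 1)) <= S + S by clear Sgt S2; move: S; clear; nia.
rewrite -S2; apply: leq_trans (leq_mul card_busy_pairs (leqnn _)) _.
rewrite big_distrl leq_sum // => i _; rewrite big_distrl leq_sum //= => j _.
case: (boolP [&& (i, j) \in M, busy i & busy j]); last by rewrite mul0n.
case/and3P=> ijM bi bj; rewrite mul1n.
have Fi : D <= #|free_at i| by rewrite MF.
have Fj : D <= #|free_at j| by rewrite MF.
apply: (@leq_trans (\sum_(v in free_at i) (D - 1))).
  by rewrite sum_nat_const leq_mul2r Fi orbT.
rewrite [leqRHS](bigID (mem (free_at i))) /=; apply: leq_trans (leq_addr _ _).
apply: leq_sum => v; rewrite inE => vi.
apply: (@leq_trans #|free_at j :\ v|).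
  move: Fj; rewrite (cardsD1 v (free_at j)); move: (#|_|); case: (v \in free_at j) => k /=;
    clear; lia.
rewrite -sum1_card big_mkcond leq_sum // => w _; rewrite !inE /f ijM vi /= eq_sym.
by case: (_ == _); case: (_ \in _).
Qed.

(** The rows with a free terminal over [v] for which at least [2 k0] edges to the
    fiber over [w] would hit the demand. *)
Definition popular k0 (v w : 'I_n) : {set 'I_n} :=
  [set i in [set i | (v, i) \in F] | 2 * k0 <= #|wanted w i|].

Lemma sum_popular k0 : 4 * k0 * n ^ 2 <= D ^ 2 * (D - 1) ->
  D ^ 2 * (D - 1) <=
  2 * \sum_(v : 'I_n) \sum_(w : 'I_n | v < w) #|popular k0 v w|.
Proof.
move=> small; set P := \sum_v _.
suff : D ^ 2 * (D - 1) * n <= n * P + n * (n * (n * (2 * k0))).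
  by move: (D ^ 2 * (D - 1)) P small; clear => d P; nia.
have cst c : n * c = \sum_(i < n) c by rewrite sum_nat_const card_ord.
apply: leq_trans sum_demand_lt _.
rewrite (cst (n * _)) /P big_distrr -big_split leq_sum //= => v _.
rewrite (cst (n * _)) [X in _ <= X + _]big_distrr /=.
rewrite [X in _ <= X + _]big_mkcond -big_split leq_sum //= => w _.
case: ltnP => [vw|_]; last first.
  by rewrite big1 // => i _; rewrite big1.
rewrite (cst (2 * k0)).
have -> : n * #|popular k0 v w| = \sum_i n * (i \in popular k0 v w).
  rewrite -big_distrr /=; congr (_ * _); rewrite -sum1_card big_mkcond.
  by apply: eq_bigr => i _; case: (_ \in _).
rewrite -big_split leq_sum //= => i _.
have -> : \sum_j 1 * f v w i j = if (v, i) \in F then #|wanted w i| else 0.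
  case: ifP => vi; last by rewrite big1 // => j _; rewrite /f vi andbF.
  rewrite -sum1_card [RHS]big_mkcond; apply: eq_bigr => j _.
  by rewrite /f vi inE mul1n; case: (_ && _).
case: ifP => // vi; rewrite !inE vi /=; case: (leqP (2 * k0) #|wanted w i|) => [_|/ltnW le].
  rewrite muln1 (leq_trans _ (leq_addr _ _)) //.
  by apply: leq_trans (max_card _) _; rewrite card_ord.
by rewrite muln0.
Qed.

End DemandCount.

Section Hits.
Import mathcomp.boot.fintype mathcomp.boot.finset.
Local Open Scope ring_scope.
Variables (R : realType) (n' l : nat).
Local Notation n := n'.+1.
Local Notation Kn := (@complete_graph n).
Hypothesis n_le_l : (n <= l)%N.
Local Notation pr := (@pr R n l).
Implicit Types (M F : {set 'I_n * 'I_n}).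

Lemma exists_subset (T : finType) (A : {set T}) k :
  (k <= #|A|)%N -> exists2 B : {set T}, B \subset A & #|B| = k.
Proof.
move=> kA; have [|C AC cC] := @exists_superset _ (~: A) (#|T| - k).
  by rewrite cardsCs setCK leq_subr leq_sub2l.
exists (~: C); first by rewrite subCset.
by rewrite cardsCs setCK cC subKn // (leq_trans kA (max_card _)).
Qed.

(** Exposing the images of at most [k0] points one by one, each forbidden set
    retains at least [k0] values that are still free. *)
Lemma perm_frac_avoid_family k0 (X : {set 'I_l}) (F : 'I_l -> {set 'I_l}) :
  (k0 <= l)%N -> (#|X| <= k0)%N -> {in X, forall i, 2 * k0 <= #|F i|}%N ->
  perm_frac R [set s : {perm 'I_l} | [forall i in X, s i \notin F i]] <=
  expR (- (k0%:R / l%:R * #|X|%:R)).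
Proof.
move=> k0l Xk0 XF.
have [X0|X0] := posnP #|X|.
  rewrite X0 mulr0 oppr0 expR0 ler_pdivrMr ?fact_gt0r // mul1r ler_nat.
  by rewrite -card_Sn max_card.
have l0 : (0 < l)%N.
  apply: leq_trans X0 _; by rewrite -[X in (_ <= X)%N]card_ord max_card.
have l0r : 0 < l%:R :> R by rewrite ltr0n.
apply: le_trans (_ : ((l - k0)%:R / l%:R) ^+ #|X| <= _); last first.
  rewrite -[X in expR X]mulNr expRM_natr lerXn2r ?nnegrE ?expR_ge0 ?divr_ge0 //.
  apply: le_trans (expR_ge1Dx _); rewrite natrB // mulrBl divff ?gt_eqF //.
rewrite ler_pdivrMr ?fact_gt0r // expr_div_n mulrAC ler_pdivlMr ?exprn_gt0 //.
rewrite -!natrX -!natrM ler_nat.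
have := card_perm_family X (fun i => ~: F i); rewrite card_ord.
set S1 := [set s | _]; set S2 := [set s : {perm 'I_l} | _].
have -> : S1 = S2.
  by apply/setP => s; rewrite !inE; apply: eq_forallb => i; rewrite inE.
move=> le; apply: leq_trans (leq_mul le (leqnn _)) _.
have Xl : (#|X| <= l)%N by rewrite -[X in (_ <= X)%N]card_ord max_card.
rewrite -(ffact_fact Xl) mulnAC [leqRHS]mulnA leq_mul2r; apply/orP; right.
apply: (@leq_trans ((l - k0) ^ #|X| * (l - #|X|) ^ #|X|)%N); last first.
  rewrite leq_mul2l; apply/orP; right.
  by have := expn_le_ffact (l - #|X|) #|X|; rewrite subnK.
apply: (@leq_trans ((l - 2 * k0) ^ #|X| * l ^ #|X|)%N).
  rewrite leq_mul2r; apply/orP; right; rewrite -prod_nat_const.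
  apply: leq_prod => i iX; rewrite cardsCs setCK card_ord leq_sub2l //; exact: XF.
rewrite -!expnMn leq_exp2r //.
apply: leq_trans (_ : ((l - k0) * (l - k0) <= _)%N); last by rewrite leq_mul2l leq_sub2l ?orbT.
by move: k0l; clear; nia.
Qed.

(** For each pair of fibers only [min (k0, .)] popular rows are exposed, so that
    [perm_frac_avoid_family] applies; since there are at most [n] popular rows,
    this keeps a proportion [k0 / n] of them, and [sum_popular] bounds their total
    number from below. *)
Lemma pr_no_hits M F D k0 : demand M F -> (4 * D * n <= #|M|)%N ->
  (4 * k0 * n ^ 2 <= D ^ 2 * (D - 1))%N -> (k0 <= n)%N ->
  (8 * n ^ 3 * l <= k0 ^ 2 * (D ^ 2 * (D - 1)))%N ->
  pr [set t | ~~ `[< hits n_le_l t M F >]] <= 16%:R^-1 ^+ (n ^ 2).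
Proof.
move=> dem big small k0n large.
have l0 : (0 < l)%N by apply: leq_trans n_le_l.
have l0r : 0 < l%:R :> R by rewrite ltr0n.
have /fin_all_exists [K KP] (p : 'I_n * 'I_n) : exists B : {set 'I_n},
    B \subset popular M F k0 p.1 p.2 /\ #|B| = minn k0 #|popular M F k0 p.1 p.2|.
  by have [B] := exists_subset (geq_minr k0 #|popular M F k0 p.1 p.2|); exists B.
pose rows (A : {set 'I_n}) : {set 'I_l} := label n_le_l @: A.
have c_rows A : #|rows A| = #|A| by rewrite card_imset //; apply: label_inj.
pose C (a : edge Kn) : {set {perm 'I_l}} := [set s : {perm 'I_l} |
  [forall i in rows (K (val a)), s i \notin
    [set y | [exists j : 'I_n, [&& i == label n_le_l j & y \in rows (wanted M F (val a).2 j)]]]]].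
apply: le_trans (_ : pr [set t : lift_of Kn l | [forall a : edge Kn, t a \in C a]] <= _).
  apply: pr_le; apply/subsetP => t; rewrite inE => /asboolPn nohit.
  rewrite inE; apply/forallP => -[[u v] a]; have /andP[/= uv _] := a.
  have -> : exist _ (u, v) a = edge_of uv by apply: val_inj.
  rewrite inE; apply/forall_inP => _ /imsetP[i iK ->]; rewrite inE.
  apply/existsP => -[_ /andP[/eqP/label_inj <- /imsetP[j]]].
  rewrite inE => /andP[ijM vjF] tij.
  apply: nohit; exists i, j, u, v; split=> //; last by rewrite lift_adjE tij.
  by have [/subsetP/(_ _ iK)] := KP (u, v); rewrite !inE => /andP[].
rewrite pr_box.
apply: le_trans (_ : \prod_(a : edge Kn) expR (- (k0%:R / l%:R * #|K ((val a).1, (val a).2)|%:R)) <= _).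
  apply: ler_prod => a _; rewrite divr_ge0 //= -surjective_pairing -(c_rows (K _)).
  have [Ksub cK] := KP (val a).
  apply: perm_frac_avoid_family; first exact: leq_trans n_le_l.
    by rewrite c_rows cK geq_minl.
  move=> _ /imsetP[i /(subsetP Ksub) + ->]; rewrite inE => /andP[_ le].
  apply: leq_trans le _; rewrite -c_rows subset_leq_card //.
  apply/subsetP => y yw; rewrite inE; apply/existsP; exists i; by rewrite eqxx.
rewrite (prod_edge (fun u v => expR (- (k0%:R / l%:R * #|K (u, v)|%:R)))).
set c := k0%:R / l%:R.
have -> : \prod_(u : 'I_n) \prod_(v : 'I_n | (u < v)%N) expR (- (c * #|K (u, v)|%:R)) =
    expR (- (c * (\sum_(u : 'I_n) \sum_(v : 'I_n | (u < v)%N) #|K (u, v)|)%:R)).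
  rewrite natr_sum mulr_sumr -sumrN expR_sum; apply: eq_bigr => u _.
  by rewrite natr_sum mulr_sumr -sumrN expR_sum.
set S := (\sum_u _)%N.
have Sle : (k0 * (D ^ 2 * (D - 1)) <= 2 * (n * S))%N.
  apply: leq_trans (leq_mul (leqnn k0) (sum_popular dem big small)) _.
  rewrite mulnCA leq_mul2l /= /S !big_distrr leq_sum //= => u _.
  rewrite !big_distrr leq_sum //= => v _; have [_ ->] := KP (u, v).
  have pn : (#|popular M F k0 u v| <= n)%N.
    by apply: leq_trans (max_card _) _; rewrite card_ord.
  rewrite /= minnE; move: (#|_|) pn k0n => p; clear.
  move: (n) => N; nia.
have e2 : 2 <= expR 1 :> R by apply: le_trans (expR_ge1Dx 1); rewrite lerD2l.
apply: le_trans (_ : expR (- (1 * (4 * n ^ 2)%:R)) <= _).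
  rewrite ler_expR lerN2 mul1r /c mulrAC ler_pdivlMr // -!natrM ler_nat.
  rewrite -(@leq_pmul2l (2 * n)) // -[leqRHS]/(2 * n * (k0 * S))%N.
  apply: leq_trans (_ : (8 * n ^ 3 * l <= _)%N).
    by move: (n) => N; clear; nia.
  apply: leq_trans large _; move: Sle; move: (D ^ 2 * (D - 1))%N (n) => d N; clear; nia.
rewrite expRN expRM_natr exprVn lef_pV2 ?posrE ?exprn_gt0 ?expR_gt0 //.
rewrite exprM lerXn2r ?nnegrE ?exprn_ge0 ?expR_ge0 //.
apply: le_trans (_ : 2 ^+ 4 <= _); first by rewrite -natrX ler_nat.
by rewrite lerXn2r ?nnegrE ?expR_ge0.
Qed.

Lemma pr_no_hits_all q D k0 : (4 * D * n <= q)%N ->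
  (4 * k0 * n ^ 2 <= D ^ 2 * (D - 1))%N -> (k0 <= n)%N ->
  (8 * n ^ 3 * l <= k0 ^ 2 * (D ^ 2 * (D - 1)))%N ->
  pr [set t | ~~ `[< forall M F, demand M F -> (q < #|M|)%N -> hits n_le_l t M F >]] <=
  4%:R^-1 ^+ (n ^ 2).
Proof.
move=> big small k0n large.
pose good (p : {set 'I_n * 'I_n} * {set 'I_n * 'I_n}) :=
  `[< demand p.1 p.2 >] && (q < #|p.1|)%N.
apply: le_trans (@pr_union_bound R n l _ good
  (fun p => [set t | ~~ `[< hits n_le_l t p.1 p.2 >]]) _ _) _.
  move=> t; rewrite inE => /asboolPn/existsNP[M /existsNP[F]].
  move=> /not_implyP[dem /not_implyP[qM none]].
  exists (M, F); first by rewrite /good qM andbT; apply/asboolP.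
  by rewrite inE; apply/asboolPn.
apply: le_trans (_ : \sum_(p : {set 'I_n * 'I_n} * {set 'I_n * 'I_n})
    16%:R^-1 ^+ (n ^ 2) <= _).
  rewrite [leRHS](bigID good) /= -[leLHS]addr0 lerD //.
    apply: ler_sum => -[M F] /andP[/asboolP dem qM].
    apply: pr_no_hits dem _ small k0n large.
    exact: leq_trans big (ltnW qM).
  by apply: sumr_ge0 => _ _; rewrite exprn_ge0 ?invr_ge0.
rewrite sumr_const card_prod -!cardsT -powersetT card_powerset cardsT card_prod !card_ord.
rewrite -[_ *+ _]mulr_natl mulnn natrM !natrX -exprMn -exprMn le_eqVlt; apply/orP; left.
by apply/eqP; congr (_ ^+ _); lra.
Qed.

End Hits.

(** * Numerical parameters *)

(** [2 ^ x] exceeds the binomial coefficient of degree [j + 1]. *)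
Lemma exp2_dominates C j : exists x0, forall x, x0 <= x -> C * x ^ j <= 2 ^ x.
Proof.
pose K := 2 ^ j.+1 * j.+1`!.
exists (j.+1 * 2 + C * K) => x x_ge.
have K0 : 0 < K by rewrite muln_gt0 expn_gt0 fact_gt0.
have jx : j.+1 <= x by apply: leq_trans x_ge; lia.
rewrite -(@leq_pmul2l K) //.
apply: (@leq_trans (x ^ j.+1)).
  rewrite mulnA expnS leq_mul2r; apply/orP; right; rewrite mulnC.
  exact: leq_trans (leq_addl _ _) x_ge.
apply: (@leq_trans ((2 * (x - j.+1)) ^ j.+1)); first by rewrite leq_exp2r //; lia.
rewrite expnMn -mulnA leq_mul2l; apply/orP; right.
have := expn_le_ffact (x - j.+1) j.+1; rewrite subnK // => /leq_trans; apply.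
by rewrite -bin_ffact mulnC leq_mul2l bin_le_exp2 orbT.
Qed.

(** The hypothesis [room] is the form in which [l >= (1 + eps) n] is used: a
    proportion [1 / k] of the fiber is free of terminals. *)
Section Thresholds.
Variables (k n l : nat).
Hypotheses (k_gt0 : 0 < k) (n_large : 60 * 1000 * k ^ 2 <= n)
  (room : k * n + l <= k * l).
Let N := n * l.
Let m := N %/ (60 * k) + 1.

Lemma n_le_l : n <= l. Proof. by rewrite -(leq_pmul2l k_gt0); apply: leq_trans room;
  apply: leq_addr. Qed.

Lemma threshold_bounds : 60 * k * m <= N + 60 * k /\ N <= 60 * k * m.
Proof.
clear n_large room; have k60 : 0 < 60 * k by rewrite muln_gt0.
have := divn_eq N (60 * k); have := ltn_pmod N k60.
rewrite /m; move: (N %/ _) (N %% _) => a b; nia.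
Qed.

Lemma small_multiple_le c : c <= 1000 -> c * k <= n.
Proof.
move=> c6; apply: leq_trans n_large; rewrite leq_mul //.
  by apply: leq_trans c6 _; rewrite leq_pmull.
by rewrite -[leqLHS]expn1 leq_pexp2l.
Qed.

Lemma small_multiple_le_size c : c <= 1000 -> c * (k * l) <= N.
Proof. by move=> c6; rewrite mulnA leq_mul2r small_multiple_le ?orbT. Qed.

(** The left side counts the reserved vertices, [q] paths with at most [2 h] inner
    vertices each, the trees grown for the next path and the slack that [sprout]
    asks for; each term other than [n * n] takes a small part of the
    [n * l / k] vertices that [room] leaves. *)
Lemma space_bound q h : m <= 2 ^ h -> 2 ^ h <= 2 * m -> 8 * k * h * q <= N ->
  l + n * n + 2 * h * q + 4 * 2 ^ h + 5 * m <= n * l.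
Proof.
move=> mh hm hq; have [m1 m2] := threshold_bounds.
have nl := n_le_l.
suff : k * (l + n * n + 2 * h * q + 4 * 2 ^ h + 5 * m) <= k * N.
  by rewrite leq_pmul2l.
have e1 : 60 * (k * l) <= N by apply: small_multiple_le_size.
have e2 : k * (n * n) + N <= k * N.
  by rewrite /N ![k * (n * _)]mulnCA -mulnDr leq_mul2l room orbT.
have e3 : 4 * (k * (2 * h * q)) <= N.
  have -> : 4 * (k * (2 * h * q)) = 8 * k * h * q by clear; lia.
  exact: hq.
have e4 : k * (4 * 2 ^ h) <= 8 * (k * m).
  by rewrite mulnCA -[8]/(4 * 2) -mulnA leq_mul2l [2 * _]mulnCA leq_mul2l hm !orbT.
have e5 : 800 * k <= N.
  have l0 : 0 < l.
    by apply: leq_trans nl; apply: leq_trans (small_multiple_le (c := 1) _); rewrite ?mul1n.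
  by apply: leq_trans (small_multiple_le_size (c := 800) _) => //;
    rewrite leq_mul2l leq_pmulr ?orbT.
rewrite (_ : k * _ = k * l + k * (n * n) + k * (2 * h * q) + k * (4 * 2 ^ h) + 5 * (k * m));
  last first.
  by move: (m) (2 ^ h) => M H; clear; lia.
move: m1; rewrite -mulnA.
move: (k * l) (k * (n * n)) (k * (2 * h * q)) (k * (4 * 2 ^ h)) (k * m) (k * N) N e1 e2 e3 e4 e5; clear.
lia.
Qed.

Lemma joined_bound : 8 * N * l <= m * (m - l).
Proof.
have [m1 m2] := threshold_bounds; have nl := n_le_l.
have e1 : 120 * (k * l) <= N by apply: small_multiple_le_size.
have e2 : N <= 120 * k * (m - l).
  move: m2 e1; rewrite -!mulnA mulnBr; move: (k * m) (k * l) N; clear; lia.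
have e3 : N * N <= (60 * 120 * k ^ 2) * (m * (m - l)).
  apply: leq_trans (leq_mul m2 e2) _; rewrite mulnACA leq_mul2r; apply/orP; right.
  by rewrite mulnACA.
have e4 : (60 * 120 * k ^ 2) * (8 * N * l) <= N * N.
  have -> : 60 * 120 * k ^ 2 * (8 * N * l) = N * (60 * 960 * k ^ 2 * l).
    by move: (N) (k ^ 2) => A B; clear; lia.
  rewrite leq_mul2l leq_mul2r; apply/orP; right; apply/orP; right.
  by apply: leq_trans n_large; rewrite leq_mul2r leq_mul2l orbT.
by rewrite -(@leq_pmul2l (60 * 120 * k ^ 2)) ?muln_gt0 ?expn_gt0 ?k_gt0 //; apply: leq_trans e3.
Qed.

End Thresholds.

Section ExpansionThresholds.
Local Open Scope ring_scope.
Variables (R : realType) (k n' l : nat).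
Local Notation n := n'.+1.
Hypotheses (k_gt0 : (0 < k)%N) (n_large : (60 * 1000 * k ^ 2 <= n)%N)
  (room : (k * n + l <= k * l)%N) (exp_large : (16 * n ^ 16 <= 2 ^ (n %/ (16 * k)))%N).
Let N := (n * l)%N.
Let m := (N %/ (60 * k) + 1)%N.

Let l_gt0 : (0 < l)%N.
Proof. exact: leq_trans (n_le_l k_gt0 room). Qed.

Let n_ge : (81 <= n)%N.
Proof.
apply: leq_trans (small_multiple_le (c := 81) k_gt0 n_large _) => //.
by rewrite leq_pmulr.
Qed.

Let N_gt0 : 0 < N%:R :> R.
Proof. by rewrite ltr0n muln_gt0 l_gt0. Qed.

Lemma density_le a : (a <= m.*2)%N -> density R n' l a <= 1 - (2 * k)%:R^-1.
Proof.
move=> am; have k2 : 0 < (2 * k)%:R :> R by rewrite ltr0n muln_gt0 k_gt0.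
rewrite /density ler_pdivrMr // mulrBl mul1r lerBrDr.
rewrite -(@ler_pM2l _ (2 * k)%:R) // mulrDr mulrA mulfV ?gt_eqF // mul1r.
rewrite -!natrM -natrD ler_nat -/N.
have [m1 _] := threshold_bounds n l k_gt0.
have e1 : (960 * (k * l) <= N)%N by apply: small_multiple_le_size.
have e2 : (k * (n * n) + N <= k * N)%N.
  by rewrite /N ![(k * (n * _))%N]mulnCA -mulnDr leq_mul2l room orbT.
have kl : (k <= k * l)%N by rewrite leq_pmulr.
have e3 : (k * a <= 2 * (k * m))%N by rewrite mulnCA leq_mul2l mul2n am orbT.
rewrite (_ : 2 * k * (n ^ 2 + 8 * a) = 2 * (k * (n * n)) + 16 * (k * a))%N; last first.
  by rewrite -mulnn; move: (n) => A; clear; lia.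
rewrite -[(2 * k * N)%N]mulnA.
move: m1 e1 e2 kl e3; rewrite -[(60 * k * _)%N]mulnA -/N -/m.
move: (k * (n * n))%N (k * N)%N (k * l)%N (k * m)%N (k * a)%N (N) => A B C D E F.
move: (k * F)%N => G; clear; lia.
Qed.

Let density_ge0 a : 0 <= density R n' l a.
Proof. by rewrite divr_ge0. Qed.

Lemma density_le1 : density R n' l m.*2 <= 1.
Proof. by apply: le_trans (density_le (leqnn _)) _; rewrite gerBl invr_ge0. Qed.

(** If [N / a] is at most [n ^ 5], a density bounded away from 1 suffices, since
    its power is exponentially small in [n]. Otherwise the density is at most the
    square root of [a / N], so that its power beats the cube of [N / a]. *)
Lemma expansion_bound a : (0 < a <= m.*2)%N ->
  16 * (N%:R / a%:R) ^+ 3 * density R n' l a ^+ (n %/ 8) <= n%:R^-1.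
Proof.
move=> /andP[a0 am].
have a0r : 0 < a%:R :> R by rewrite ltr0n.
have n0r : 0 < n%:R :> R by rewrite ltr0n.
have rho_le := density_le am; have rho_ge0 := density_ge0 a.
have rho_le1 : density R n' l a <= 1.
  by apply: le_trans rho_le _; rewrite gerBl invr_ge0.
set rho := density R n' l a in rho_le rho_ge0 rho_le1 *.
have [small|large] := leqP N (n ^ 5 * a).
  have e2 : 2 <= expR 1 :> R by apply: le_trans (expR_ge1Dx 1); rewrite lerD2l.
  have half : rho ^+ (2 * k) <= 2^-1.
    apply: le_trans (_ : (expR (- (2 * k)%:R^-1)) ^+ (2 * k) <= _).
      rewrite lerXn2r ?nnegrE ?expR_ge0 //; apply: le_trans rho_le _.
      exact: expR_ge1Dx.
    rewrite -expRM_natr mulNr mulVf ?pnatr_eq0 ?muln_eq0 ?negb_or -?lt0n ?k_gt0 //.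
    by rewrite expRN lef_pV2 ?posrE ?expR_gt0.
  have rho_pow : rho ^+ (n %/ 8) <= 2^-1 ^+ (n %/ (16 * k)).
    apply: le_trans (_ : rho ^+ (2 * k * (n %/ (16 * k))) <= _).
      apply: ler_wiXn2l => //; rewrite leq_divRL // -mulnA mulnC -mulnA.
      by rewrite (_ : 8 * (2 * k) = 16 * k)%N ?leq_trunc_div // mulnA.
    by rewrite exprM lerXn2r ?nnegrE ?exprn_ge0 ?invr_ge0.
  apply: le_trans (_ : 16 * (n ^ 5)%:R ^+ 3 * 2^-1 ^+ (n %/ (16 * k)) <= _).
    rewrite ler_pM ?mulr_ge0 ?exprn_ge0 ?divr_ge0 // ler_wpM2l //.
    rewrite lerXn2r ?nnegrE ?divr_ge0 // ler_pdivrMr // -natrM ler_nat //.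
  rewrite exprVn ler_pdivrMr ?exprn_gt0 // [leRHS]mulrC ler_pdivlMr // -natrX -natrX.
  rewrite -!natrM ler_nat -expnM -mulnA -expnSr; exact: exp_large.
(* Here a is at least n ^ 5 times smaller than N, so N >= 81 * n ^ 4 * a. *)
have rho2 : rho ^+ 2 <= a%:R / N%:R.
  rewrite /rho /density expr_div_n ler_pdivrMr ?exprn_gt0 // [(n * l)%:R ^+ 2]expr2 mulrA divfK ?gt_eqF //.
  rewrite -natrX -natrM ler_nat.
  apply: (@leq_trans ((9 * (n ^ 2 * a)) ^ 2)).
    rewrite leq_exp2r //; have : (n ^ 2 <= n ^ 2 * a)%N by rewrite leq_pmulr.
    have : (a <= n ^ 2 * a)%N by rewrite leq_pmull ?expn_gt0.
    by move: (n ^ 2)%N => A; clear; lia.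
  have -> : ((9 * (n ^ 2 * a)) ^ 2 = a * (81 * n ^ 4 * a))%N.
    by rewrite (expnD n 2 2) -[LHS]mulnn; move: (n ^ 2)%N => A; clear; lia.
  rewrite leq_mul2l; apply/orP; right; apply: leq_trans (ltnW large).
  by rewrite leq_mul2r expnS leq_mul2r n_ge !orbT.
apply: le_trans (_ : 16 * (N%:R / a%:R) ^+ 3 * (a%:R / N%:R) ^+ 4 <= _).
  rewrite ler_wpM2l ?mulr_ge0 ?exprn_ge0 ?divr_ge0 ?(ltW N_gt0) //.
  apply: le_trans (_ : rho ^+ (2 * 4) <= _).
    by apply: ler_wiXn2l => //; rewrite leq_divRL //; apply: leq_trans n_ge.
  by rewrite exprM lerXn2r ?nnegrE ?exprn_ge0 ?divr_ge0 ?(ltW N_gt0).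
have -> : 16 * (N%:R / a%:R) ^+ 3 * (a%:R / N%:R) ^+ 4 = 16 * a%:R / N%:R :> R.
  by field; rewrite !gt_eqF.
rewrite ler_pdivrMr // [leRHS]mulrC ler_pdivlMr // -!natrM ler_nat.
apply: leq_trans (ltnW large); rewrite mulnAC leq_mul2r; apply/orP; right.
rewrite mulnC expnS leq_mul2l; apply/orP; right.
by apply: leq_trans (_ : n ^ 1 <= _)%N; [apply: leq_trans n_ge | rewrite leq_pexp2l].
Qed.

End ExpansionThresholds.

(** With [D] about [n / c] and [k0] about [D ^ 3 / (4 n ^ 2)], the right side of
    the last inequality is of order [n ^ 5 / c ^ 9]. *)
Lemma hits_parameters c n l : 0 < c -> (8 * c) ^ 10 <= n -> l <= c * n ->
  exists D k0, [/\ c * D <= n, 4 * k0 * n ^ 2 <= D ^ 2 * (D - 1), k0 <= n &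
    8 * n ^ 3 * l <= k0 ^ 2 * (D ^ 2 * (D - 1))].
Proof.
move=> c0 n_large l_le.
have pow j : j <= 10 -> (8 * c) ^ j <= n.
  by move=> j10; apply: leq_trans n_large; rewrite leq_pexp2l // muln_gt0.
have n0 : 0 < n by apply: leq_trans (pow 0 _).
pose D := n %/ c; pose X := D ^ 2 * (D - 1); pose k0 := X %/ (4 * n ^ 2).
have cD : c * D <= n by rewrite mulnC leq_trunc_div.
have D2 : 2 <= D.
  rewrite leq_divRL //; apply: leq_trans (pow 1 _) => //.
  by rewrite expn1 leq_mul2r orbT.
have nD : n <= 2 * c * D.
  have := divn_eq n c; have := ltn_pmod n c0; rewrite -/D; move: (n %% c) => r.
  by move: D2; clear; nia.
have DX : D ^ 3 <= 2 * X.
  rewrite /X mulnCA expnSr leq_mul2l; apply/orP; right.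
  by move: D2; clear; lia.
have nX : n ^ 3 <= 16 * c ^ 3 * X.
  apply: (@leq_trans ((2 * c * D) ^ 3)); first by rewrite leq_exp2r.
  rewrite !expnMn; have := leq_mul (leqnn (c ^ 3)) DX.
  by move: (c ^ 3) (D ^ 3) (X) => p d x; clear; lia.
have n2 : 0 < n ^ 2 by rewrite expn_gt0 n0.
have k0X : X < 4 * n ^ 2 * k0.+1 by rewrite mulnC ltn_ceil // muln_gt0.
have nk : n <= 64 * c ^ 3 * k0.+1.
  rewrite -(@leq_pmul2r (n ^ 2)) // -expnS; apply: leq_trans nX _.
  apply: leq_trans (leq_mul (leqnn _) (ltnW k0X)) _.
  by move: (c ^ 3) (n ^ 2) => a b; clear; lia.
have k0_gt0 : 0 < k0.
  rewrite lt0n; apply/eqP => k00; move: nk; rewrite k00 muln1 leqNgt => /negP; apply.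
  apply: leq_trans (pow 3 _) => //; rewrite expnMn ltn_pmul2r ?expn_gt0 ?c0 //.
have nk2 : n <= 128 * c ^ 3 * k0.
  apply: leq_trans nk _; move: (c ^ 3) k0_gt0 => a; clear; nia.
exists D, k0; split=> //.
- by rewrite mulnAC mulnC leq_trunc_div.
- have Dn : D <= n by apply: leq_div.
  have Xn : X <= n * (4 * n ^ 2).
    rewrite /X mulnC leq_mul //; first exact: leq_trans (leq_subr _ _) Dn.
    by apply: leq_trans (leq_pmull _ _); rewrite ?leq_exp2r.
  by apply: leq_trans (leq_div2r _ Xn) _; rewrite mulnK // muln_gt0.
pose K := (128 * c ^ 3) ^ 2 * (16 * c ^ 3).
have K0 : 0 < K.
  have c3 : 0 < c ^ 3 by rewrite expn_gt0 c0.
  by rewrite /K; move: (c ^ 3) c3 => e e0; rewrite !muln_gt0 ?expn_gt0 ?muln_gt0 e0.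
have Kn : K * (8 * c) <= n.
  apply: leq_trans (pow 10 _) => //; rewrite -[10]/(6 + 3 + 1) !expnD expn1 leq_mul2r.
  apply/orP; right; rewrite leq_mul // ?(expnMn 8 c 3) ?leq_mul2r ?orbT //.
  by rewrite -[6]/(3 * 2) expnM leq_exp2r // expnMn leq_mul2r orbT.
rewrite -(@leq_pmul2l K) //.
apply: (@leq_trans (n ^ 2 * n ^ 3)); last first.
  apply: (@leq_trans ((128 * c ^ 3 * k0) ^ 2 * (16 * c ^ 3 * X))).
    by rewrite leq_mul // leq_exp2r.
  rewrite -/X /K; move: (c ^ 3) (X) (k0) => p x y; rewrite -!mulnn; clear; lia.
apply: (@leq_trans (K * (8 * n ^ 3 * (c * n)))); first by rewrite !leq_mul2l l_le !orbT.
have -> : K * (8 * n ^ 3 * (c * n)) = K * (8 * c) * n * n ^ 3.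
  by move: (n ^ 3) (K) => p x; clear; lia.
by rewrite leq_mul2r -mulnn leq_mul2r Kn !orbT.
Qed.

Section Final.
Import mathcomp.boot.fintype mathcomp.boot.finset.
Local Open Scope ring_scope.
Variables (R : realType) (n' l : nat).
Local Notation n := n'.+1.
Local Notation Kn := (@complete_graph n).
Hypothesis nl : (n <= l)%N.
Local Notation pr := (@pr R n l).

Lemma card_reserved : (#|reserved n' l| <= l + n * n)%N.
Proof.
pose A : {set 'I_n * 'I_l} := setX [set ord0] [set: 'I_l].
pose B : {set 'I_n * 'I_l} := setX [set: 'I_n] [set label nl i | i in [set: 'I_n]].
have : reserved n' l \subset A :|: B.
  apply/subsetP => -[u i]; rewrite !inE /= => /orP[->//|i_n].
  apply/orP; right; apply/imsetP; exists (Ordinal i_n); first by rewrite inE.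
  by apply: val_inj.
move/subset_leq_card/leq_trans; apply; apply: leq_trans (leq_card_setU _ _) _.
rewrite !cardsX cards1 !cardsT !card_ord mul1n leq_add2l leq_mul2l.
by rewrite (leq_trans (leq_imset_card _ _)) ?orbT // cardsT card_ord.
Qed.

(** The good events are required of the normalised lift; [normalise] being
    injective, their probability is the same as for the lift itself. *)
Lemma pr_hajos m h q (a b c : R) :
  (0 < m)%N -> (m <= 2 ^ h)%N ->
  (l + n * n + 2 * h * q + 4 * 2 ^ h + 5 * m <= n * l)%N ->
  pr [set t : lift_of Kn l | ~~ `[< joined (lift_adj t) m >]] <= a ->
  pr [set t : lift_of Kn l | ~~ `[< expanding m t >]] <= b ->
  pr [set t | ~~ `[< forall M F, demand M F -> (q < #|M|)%N -> hits nl t M F >]] <= c ->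
  1 - (a + b + c) <= pr [set s : lift_of Kn l | hajos_number (lift_adj s) == n].
Proof.
move=> m0 mh space Ja Eb Hc.
set A := [set t : lift_of Kn l | ~~ `[< joined _ _ >]] in Ja.
set B := [set t : lift_of Kn l | ~~ _] in Eb.
set C := [set t : lift_of Kn l | ~~ _] in Hc.
set Good := [set s | _].
rewrite lerBlDr -lerBlDl -pr_setC.
apply: le_trans (_ : pr (A :|: B :|: C) <= _); last first.
  by apply: le_trans (pr_setU _ _ _) _; apply: lerD => //; apply: le_trans (pr_setU _ _ _) _;
    apply: lerD.
rewrite ler_pM2r ?invr_gt0 ?card_lift_gt0 // ler_nat.
rewrite -(card_imset _ (@normalise_inj n' l)); apply: subset_leq_card.
apply/subsetP => _ /imsetP[s + ->]; rewrite in_setC; apply: contraNT.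
rewrite !in_setU !negb_or !inE !negbK => /andP[/andP[/asboolP Js /asboolP Es] /asboolP Hs].
apply/eqP; apply: hajos_number_lift.
have [phi [phi0 phiq]] := exists_pairing Hs.
apply: (clique_of_pairing (nl := nl) phi0 Js m0 mh Es).
apply: leq_trans space; rewrite !leq_add2r leq_add ?card_reserved //.
by rewrite leq_mul2l phiq orbT.
Qed.

End Final.

(** * Almost every lift contains the clique *)

Section Eventually.
Import mathcomp.boot.fintype mathcomp.boot.finset.
Local Open Scope ring_scope.

Lemma exp_large_eventually k : (0 < k)%N ->
  exists n0, forall n, (n0 <= n)%N -> (16 * n ^ 16 <= 2 ^ (n %/ (16 * k)))%N.
Proof.
move=> k0; have d0 : (0 < 16 * k)%N by rewrite muln_gt0.
have [x0 H] := exp2_dominates (2 * (16 * (16 * k) ^ 16)) 16.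
exists (16 * k * x0)%N => n n_ge; set y := (n %/ (16 * k))%N.
have xy : (x0 <= y.+1)%N by apply: leqW; rewrite leq_divRL // mulnC.
have ny : (n <= 16 * k * y.+1)%N by rewrite mulnC ltnW // ltn_ceil.
have := H _ xy; rewrite -mulnA [(2 ^ y.+1)%N]expnS leq_pmul2l //; apply: leq_trans.
by rewrite -mulnA leq_mul2l -expnMn leq_exp2r.
Qed.

Lemma inv_pow_le (R : realType) (x N : nat) : (0 < x <= N)%N ->
  4%:R^-1 ^+ N <= x%:R^-1 :> R.
Proof.
move=> /andP[x0 xN]; rewrite exprVn lef_pV2 ?posrE ?exprn_gt0 ?ltr0n //.
rewrite -natrX ler_nat; apply: leq_trans xN _; apply: ltnW; exact: ltn_expl.
Qed.

(** Either [8 k h n ^ 2 <= n l], and there is room for joining all pairs of rows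
    by paths of spare vertices, or [l <= c n] with [c = 32 k h], where [h] is
    logarithmic in [n], and the unmatched pairs number at most [4 D n] with
    [D] about [n / c]. *)
Lemma clique_eventually (R : realType) k : (0 < k)%N ->
  exists n0, forall n' l, (n0 <= n'.+1)%N -> (k * n'.+1 + l <= k * l)%N ->
  1 - 4 / n'.+1%:R <= @pr R n'.+1 l
    [set s : lift_of (@complete_graph n'.+1) l | hajos_number (lift_adj s) == n'.+1].
Proof.
move=> k0.
have [n1 Hn1] := exp_large_eventually k0.
have [h0 Hh0] := exp2_dominates ((256 * k) ^ 21) 21.
exists (n1 + 60 * 1000 * k ^ 2 + (60 * k * 2 ^ h0).+1)%N => n' l.
set n := n'.+1 => n_ge room.
have exp_large : (16 * n ^ 16 <= 2 ^ (n %/ (16 * k)))%N.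
  by apply: Hn1; apply: leq_trans n_ge; rewrite -addnA leq_addr.
have n_large : (60 * 1000 * k ^ 2 <= n)%N.
  by apply: leq_trans n_ge; rewrite addnAC leq_addl.
have n_h0 : (60 * k * 2 ^ h0 < n)%N by apply: leq_trans n_ge; rewrite leq_addl.
have nl := n_le_l k0 room.
have l0 : (0 < l)%N by apply: leq_trans nl.
have [m1 m2] := threshold_bounds n l k0.
set N := (n * l)%N; set m := (N %/ (60 * k) + 1)%N in m1 m2.
have nN : (n <= N)%N by rewrite leq_pmulr.
have m0 : (0 < m)%N by rewrite /m addn1.
have m_gt1 : (1 < m)%N.
  rewrite ltnNge; apply/negP => mle; move: n_h0; rewrite ltnNge => /negP; apply.
  apply: leq_trans nN _; apply: leq_trans m2 _; rewrite leq_mul2l.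
  by rewrite (leq_trans mle) ?expn_gt0 ?orbT.
pose h := up_log 2 m.
have mh : (m <= 2 ^ h)%N by apply: up_logP.
have h_gt0 : (0 < h)%N by rewrite lt0n; apply: contraTneq mh => ->; rewrite -ltnNge.
have hm : (2 ^ h <= 2 * m)%N.
  have /andP[lt _] := up_log_bounds (isT : 1 < 2)%N m_gt1.
  by rewrite -/h in lt; rewrite -(prednK h_gt0) expnS leq_mul2l ltnW.
(* h tends to infinity with n, since 2 ^ h >= m >= n / (60 * k). *)
have h_ge : (h0 <= h)%N.
  rewrite leqNgt; apply/negP => hh0; move: n_h0; rewrite ltnNge => /negP; apply.
  apply: leq_trans nN _; apply: leq_trans m2 _; rewrite leq_mul2l.
  by rewrite (leq_trans mh) ?orbT // leq_exp2l // ltnW.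
have n8 : (8 <= n)%N.
  apply: leq_trans (small_multiple_le (c := 8) k0 n_large _) => //; by rewrite leq_pmulr.
have m4 : (4 * m <= N)%N.
  have e1 : (60 * (k * l) <= N)%N by apply: small_multiple_le_size.
  have e2 : (60 * k <= N)%N by apply: leq_trans e1; rewrite leq_mul2l leq_pmulr ?orbT.
  have e3 : (m <= k * m)%N by rewrite leq_pmull.
  by move: m1 e2 e3; rewrite -/N -mulnA; move: (k * m)%N (N) => A B; clear; lia.
have twoN : (2 ^ h <= N)%N.
  by apply: leq_trans hm _; apply: leq_trans m4; rewrite leq_mul2r orbT.
have nR : 0 < n%:R :> R by rewrite ltr0n.
have prJ : @pr R n l [set t | ~~ `[< joined (lift_adj t) m >]] <= n%:R^-1.
  apply: le_trans (pr_not_joined R l0 (joined_bound k0 n_large room)) _.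
  by apply: inv_pow_le; rewrite nN.
have prE : @pr R n l [set t | ~~ `[< expanding m t >]] <= 2 * n%:R^-1.
  apply: (pr_not_expanding nl n8 m0 m4).
  - exact: (density_le1 R k0 n_large room).
  - by rewrite -div1r mulrA mulr1 ler_pdivrMr // mul1r ler_nat (leq_trans _ n8).
  by move=> a; apply: expansion_bound.
have sum4 : 4 / n%:R = n%:R^-1 + 2 * n%:R^-1 + n%:R^-1 :> R by lra.
rewrite sum4.
have [big|small] := leqP (8 * k * h * n ^ 2)%N N.
  apply: (pr_hajos (nl := nl) (q := (n ^ 2)%N) m0 mh _ prJ prE); first exact: space_bound.
  rewrite [X in pr _ X](_ : _ = finset.set0) ?cards0 /pr ?mul0r ?invr_ge0 //.
    by rewrite cards0 mul0r invr_ge0.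
  apply/setP => t; rewrite !inE; apply/negbTE; rewrite negbK; apply/asboolP => M F _.
  rewrite ltnNge => /negP[]; apply: leq_trans (max_card _) _.
  by rewrite card_prod !card_ord.
pose c := (32 * k * h)%N.
have c0 : (0 < c)%N by rewrite !muln_gt0 k0.
have lc : (l <= c * n)%N.
  rewrite -(@leq_pmul2l n) //; apply: leq_trans (ltnW small) _.
  by rewrite /c -mulnn; move: (n) => x; clear; nia.
(* Otherwise N would be bounded by a polynomial in h, against 2 ^ h <= N. *)
have n_c : ((8 * c) ^ 10 <= n)%N.
  rewrite leqNgt; apply/negP => n_lt.
  have := leq_trans (Hh0 h h_ge) twoN; rewrite leqNgt => /negP; apply.
  apply: leq_trans small _; rewrite -expnMn (_ : 256 * k * h = 8 * c)%N; last first.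
    by rewrite /c; clear; lia.
  rewrite (expnS _ 20) leq_mul //; first by rewrite /c; clear; nia.
  by rewrite -[20%N]/(10 * 2)%N expnM leq_exp2r // ltnW.
have [D [b0 [cD s1 s2 s3]]] := hits_parameters c0 n_c lc.
apply: (pr_hajos (nl := nl) (q := (4 * D * n)%N) m0 mh _ prJ prE).
  apply: space_bound => //; rewrite (_ : 8 * k * h * (4 * D * n) = n * (c * D))%N.
    by rewrite leq_mul2l (leq_trans cD) ?orbT.
  by rewrite /c; move: (n) => x; clear; lia.
apply: le_trans (pr_no_hits_all R nl (leqnn _) s1 s2 s3) _.
by apply: inv_pow_le; rewrite /= -[leqLHS]expn1 leq_pexp2l.
Qed.

End Eventually.

Local Open Scope classical_set_scope.
Local Open Scope ring_scope.

Theorem theorem1p2 (R : realType) (eps : R) (l : nat -> nat)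
    (eps_gt0 : 0 < eps)
    (l_gt0 : forall n : nat, (0 < l n)%N)
    (l_ge : forall n : nat, (1 + eps) * n%:R <= (l n)%:R :> R) :
  lift_probability R (@complete_graph n)
    (fun G : rel ('I_n * 'I_(l n)) => hajos_number G == n)
    @[n --> \oo] --> (1 : R).
Proof.
(* 1 / k is a lower bound for eps / (1 + eps), the proportion of spare labels. *)
have [k k0 epsk] : exists2 k : nat, (0 < k)%N & 1 + eps <= eps * k%:R.
  exists (Num.bound ((1 + eps) / eps)); last first.
    by rewrite -ler_pdivrMl // mulrC ltW // archi_boundP // divr_ge0 ?ltW ?addr_gt0.
  rewrite -(@ltr0n R); apply: le_lt_trans (archi_boundP _) => //.
    by rewrite divr_ge0 ?ltW ?addr_gt0.
  by rewrite divr_ge0 ?ltW ?addr_gt0.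
have [n0 large] := clique_eventually R k0.
have room n : (k * n + l n <= k * l n)%N.
  rewrite -(@ler_nat R) natrD !natrM -(@ler_pM2l _ eps) // mulrDr !mulrA -lerBrDr.
  apply: le_trans (_ : (eps * k%:R - eps) * (l n)%:R <= _); last first.
    by rewrite mulrBl.
  apply: le_trans (_ : (eps * k%:R - eps) * ((1 + eps) * n%:R) <= _); last first.
    by apply: ler_wpM2l; rewrite // subr_ge0; apply: le_trans epsk; rewrite lerDr.
  rewrite mulrA ler_wpM2r // mulrBl; nra.
apply/cvgrPdist_le => e e0; near=> n.
have n_gt0 : (0 < n)%N by near: n; exact: nbhs_infty_gt.
have n_n0 : (n0 <= n)%N by near: n; exact: nbhs_infty_ge.
have n_e : 4 / e <= n%:R by near: n; exact: nbhs_infty_ger.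
have := large n.-1 (l n); rewrite prednK // => /(_ n_n0 (room n)) le.
rewrite ger0_norm; last first.
  rewrite subr_ge0 /lift_probability ler_pdivrMr ?card_lift_gt0 // mul1r ler_nat.
  exact: max_card.
rewrite lerBlDl -lerBlDr; apply: le_trans le.
rewrite lerD2l lerN2 ler_pdivrMr ?ltr0n // mulrC -ler_pdivrMr //.
Unshelve. all: by end_near.
Qed.
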